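(* Let $X$ be an arbitrary topological space and let $\mathcal A\colon X\to\mathcal R_K^{\mathrm{sa}}(H)$ be a graph continuous map having a spectral section. Then $\mathcal A$ is Riesz continuous.
   Context: $H$ is a separable complex Hilbert space of infinite dimension. $\mathcal R(H)$ is the set of regular (closed densely defined) operators on $H$. $\mathcal R_K^{\mathrm{sa}}(H)$ is the set of regular self-adjoint operators $A$ on $H$ with compact resolvents, i.e. with $(A+i)^{-1}$ compact. The Riesz topology on $\mathcal R(H)$ is the topology induced by the bounded transform $f\colon\mathcal R(H)\to\mathcal B(H)$, $f(A)=A(1+A^*A)^{-1/2}$, from the norm topology on $\mathcal B(H)$. The graph topology on $\mathcal R(H)$ is the topology induced by the map taking $A$ to the orthogonal projection of $H\oplus H$ onto the graph of $A$, from the norm topology on projections. Riesz (graph) continuous means continuous with respect to the Riesz (graph) topology. A spectral section for $\mathcal A=(\mathcal A_x)_{x\in X}$ is a norm continuous family $(P_x)_{x\in X}$ of orthogonal projections in $H$ for which there is a continuous function $r\colon X\to(0,\infty)$ such that $\mathbb 1_{[r_x,+\infty)}(\mathcal A_x)\le P_x\le\mathbb 1_{(-r_x,+\infty)}(\mathcal A_x)$ for every $x\in X$, where $\mathbb 1_S$ is the characteristic function of $S\subset\mathbb R$. *)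

(* Defs.v *)
From HB Require Import structures.
From mathcomp Require Import all_boot all_order all_algebra.
From mathcomp Require Import all_classical all_reals all_analysis.
From mathcomp Require Import complex sesquilinear.
From mathcomp Require Import ring lra.

Set Implicit Arguments.
Unset Strict Implicit.
Unset Printing Implicit Defensive.

Import Order.TTheory GRing.Theory Num.Theory.
Import numFieldNormedType.Exports.

Local Open Scope classical_set_scope.
Local Open Scope complex_scope.
Local Open Scope ring_scope.

(* Inner products are linear in the first argument and conjugate-linear in the
   second one. *)

Section inner_product_norm.
Context {R : realType} {V : lmodType R[i]} (d : {dot V for Num.conj}).

Definition ipnorm (v : V) : R := Num.sqrt (complex.Re (d v v)).

Lemma ipnorm_sqr v : ipnorm v ^+ 2 = complex.Re (d v v).
Proof.
have := dnorm_ge0 d v; rewrite /ipnorm; case: (d v v) => a b /=.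
by rewrite lecE /= => /andP[_ a0]; rewrite sqr_sqrtr.
Qed.

Lemma ipnorm_ge0 v : 0 <= ipnorm v.
Proof. exact: sqrtr_ge0. Qed.

Lemma ipnorm_eq0 v : ipnorm v = 0 -> v = 0.
Proof.
move=> v0; have := dnorm_ge0 d v; have := dnorm_eq0 d v.
have := ipnorm_sqr v; rewrite v0 expr0n /=; case: (d v v) => a b /= <-.
rewrite lecE /= => h /andP[/eqP b0 _]; apply/eqP; rewrite -h b0.
by rewrite eqE /= !eqxx.
Qed.

Lemma ipnorm0 : ipnorm 0 = 0.
Proof. by rewrite /ipnorm linear0r /= sqrtr0. Qed.

Let ReM (r : R) (z : R[i]) : complex.Re (r%:C * z) = r * complex.Re z.
Proof. by case: z => x y /=; rewrite mul0r subr0. Qed.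

Let ReC (z : R[i]) : complex.Re (Num.conj z) = complex.Re z.
Proof. by case: z. Qed.

Lemma ipnormZ (a : R[i]) v : ipnorm (a *: v) = complex.Re `|a| * ipnorm v.
Proof.
have := normr_ge0 a; have : `|a| \is Num.real by exact: normr_real.
move/RRe_real; set n := complex.Re `|a| => na; rewrite -na lecR => n0.
apply/eqP; rewrite -(eqrXn2 (n := 2)) ?mulr_ge0 ?ipnorm_ge0 //.
by rewrite exprMn !ipnorm_sqr dnormZ -na -rmorphXn ReM.
Qed.

Lemma ipnormN v : ipnorm (- v) = ipnorm v.
Proof. by rewrite -scaleN1r ipnormZ normrN1 /= mul1r. Qed.

Lemma ipnorm_combE (t : R) u v : ipnorm (t%:C *: u + v) ^+ 2 =
  t ^+ 2 * ipnorm u ^+ 2 + 2 * t * complex.Re (d u v) + ipnorm v ^+ 2.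
Proof.
rewrite !ipnorm_sqr dnormD dnormZ.
have -> : `|t%:C| ^+ 2 = (t ^+ 2)%:C :> R[i].
  by rewrite normc_def /= expr0n addr0 sqrtr_sqr -rmorphXn /= real_normK ?num_real.
by rewrite linearZl_LR /= !raddfD /= !ReC !ReM; ring.
Qed.

Lemma ipnormD u v : ipnorm (u + v) <= ipnorm u + ipnorm v.
Proof.
rewrite -(ler_pXn2r (n := 2)) ?nnegrE ?addr_ge0 ?ipnorm_ge0 //.
have := ipnorm_combE 1 u v; rewrite scale1r => ->.
have a0 := ipnorm_ge0 u; have b0 := ipnorm_ge0 v.
suff : complex.Re (d u v) <= ipnorm u * ipnorm v by nra.
have [u0|u0] := eqVneq (ipnorm u) 0.
  by rewrite u0 (ipnorm_eq0 u0) linear0l /= mul0r.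
have [c0|c0] := ltP (complex.Re (d u v)) 0.
  by rewrite (le_trans (ltW c0)) ?mulr_ge0.
rewrite -(ler_pXn2r (n := 2)) ?nnegrE ?mulr_ge0 //.
have := sqr_ge0 (ipnorm ((- complex.Re (d u v) / ipnorm u ^+ 2)%:C *: u + v)).
rewrite ipnorm_combE; set c := complex.Re _; set a := ipnorm u; set b := ipnorm v.
have -> : (- c / a ^+ 2) ^+ 2 * a ^+ 2 + 2 * (- c / a ^+ 2) * c + b ^+ 2 =
  (a ^+ 2 * b ^+ 2 - c ^+ 2) / a ^+ 2 by field.
rewrite pmulr_lge0 ?invr_gt0 ?exprn_gt0 ?lt_def ?u0 // subr_ge0 exprMn.
by [].
Qed.

End inner_product_norm.

Section bounded_operators.
Context {R : realType} {V : lmodType R[i]} (d : {dot V for Num.conj}).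

Record bounded_op := BoundedOp {
  bop_fun :> V -> V ;
  bop_linear : forall (a : R[i]) u v,
    bop_fun (a *: u + v) = a *: bop_fun u + bop_fun v ;
  bop_bounded : exists M : R, forall v, ipnorm d (bop_fun v) <= M * ipnorm d v }.

HB.instance Definition _ (T : bounded_op) :=
  GRing.isLinear.Build R[i] V V *:%R T (bop_linear T).

HB.instance Definition _ := gen_eqMixin bounded_op.
HB.instance Definition _ := gen_choiceMixin bounded_op.

Lemma bop_ext (S T : bounded_op) : S =1 T -> S = T.
Proof.
move=> /funext; case: S T => [S lS bS] [T lT bT] /= ST.
by case: _ / ST in lT bT *; rewrite (Prop_irrelevance lS lT) (Prop_irrelevance bS bT).
Qed.

Lemma zero_linear (a : R[i]) (u v : V) : 0 = a *: 0 + 0 :> V.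
Proof. by rewrite scaler0 addr0. Qed.

Lemma zero_bounded : exists M : R, forall v, ipnorm d 0 <= M * ipnorm d v.
Proof. by exists 0 => v; rewrite mul0r ipnorm0. Qed.

Definition zero_bop : bounded_op := BoundedOp zero_linear zero_bounded.

Definition opnorm (T : V -> V) : R :=
  sup [set ipnorm d (T v) | v in [set v | ipnorm d v <= 1]].

Definition bop_dist (S T : bounded_op) : R := opnorm (fun v => S v - T v).

Implicit Types S T U : bounded_op.

Lemma bop_dist_ub S T v : ipnorm d v <= 1 ->
  ipnorm d (S v - T v) <= bop_dist S T.
Proof.
move=> v1; apply: ub_le_sup; last by exists v.
have [M hM] := bop_bounded S; have [N hN] := bop_bounded T.
exists (`|M| + `|N|) => _ [w /= w1 <-].
rewrite (le_trans (ipnormD _ _ _))// ipnormN lerD//.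
  rewrite (le_trans (hM _))// (le_trans (ler_norm _))// normrM ler_piMr//.
  by rewrite ger0_norm ?ipnorm_ge0.
rewrite (le_trans (hN _))// (le_trans (ler_norm _))// normrM ler_piMr//.
by rewrite ger0_norm ?ipnorm_ge0.
Qed.

Lemma bop_dist_le S T (M : R) :
  (forall v, ipnorm d v <= 1 -> ipnorm d (S v - T v) <= M) ->
  bop_dist S T <= M.
Proof.
move=> h; apply: ge_sup.
  by exists (ipnorm d (S 0 - T 0)), 0 => //=; rewrite ipnorm0.
by move=> _ [v /= v1 <-]; exact: h.
Qed.

Lemma bop_distxx S : bop_dist S S = 0.
Proof.
apply/eqP; rewrite eq_le; apply/andP; split.
  by apply: bop_dist_le => v _; rewrite subrr ipnorm0.
by rewrite (le_trans (ipnorm_ge0 d (S 0 - S 0)))// bop_dist_ub ?ipnorm0.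
Qed.

Lemma bop_dist_positivity S T : bop_dist S T = 0 -> S = T.
Proof.
move=> ST; apply: bop_ext => v; apply/eqP; rewrite -subr_eq0; apply/eqP.
have [v0|v0] := eqVneq (ipnorm d v) 0.
  by rewrite (ipnorm_eq0 v0) (linear0 S) (linear0 T) subrr.
have vp : 0 < ipnorm d v by rewrite lt_def v0 ipnorm_ge0.
apply: (@ipnorm_eq0 _ _ d).
pose c : R[i] := ((ipnorm d v)^-1)%:C.
have nc : complex.Re `|c| = (ipnorm d v)^-1.
  by rewrite normc_def /= expr0n addr0 sqrtr_sqr gtr0_norm ?invr_gt0.
have := @bop_dist_ub S T (c *: v); rewrite ST ipnormZ nc mulVf// => /(_ (lexx _)).
rewrite (linearZZ S) (linearZZ T) -scalerBr ipnormZ nc => h.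
apply/eqP; rewrite eq_le ipnorm_ge0 andbT.
by rewrite -(pmulr_rle0 _ (_ : 0 < (ipnorm d v)^-1)) ?invr_gt0.
Qed.

Lemma bop_dist_sym S T : bop_dist S T = bop_dist T S.
Proof.
by congr sup; apply: eq_imagel => v _; rewrite -opprB ipnormN.
Qed.

Lemma bop_dist_triangle T S U : bop_dist S U <= bop_dist S T + bop_dist T U.
Proof.
apply: bop_dist_le => v v1; rewrite -(subrK (T v) (S v)) -addrA.
by rewrite (le_trans (ipnormD _ _ _))// lerD// bop_dist_ub.
Qed.

HB.instance Definition _ := isMetric.Build R bounded_op
  bop_distxx bop_dist_positivity bop_dist_sym bop_dist_triangle.

Definition positive_op (T : V -> V) := forall v, 0 <= d (T v) v.

Definition le_op (S T : V -> V) := forall v, d (S v) v <= d (T v) v.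

Definition orthogonal_projection (P : V -> V) :=
  (forall v, P (P v) = P v) /\ (forall u v, d (P u) v = d u (P v)).

End bounded_operators.

Section orthogonal_sum.
Context {R : realType} {V : lmodType R[i]} (d : {dot V for Num.conj}).

Definition dot_sum (p q : V * V) : R[i] := d p.1 q.1 + d p.2 q.2.

Lemma dot_sum_bilinear :
  bilinear_for *%R (Num.conj \; *%R) dot_sum.
Proof.
split=> [u|u] a p q; rewrite /dot_sum /=.
  by rewrite !linearPl; ring.
by rewrite !linearPr /=; ring.
Qed.

Lemma dot_sum_hermitian p q :
  dot_sum p q = (-1) ^+ false * Num.conj (dot_sum q p).
Proof. by rewrite /dot_sum hermC (hermC d p.2) !expr0 !mul1r rmorphD. Qed.

Lemma dot_sum_gt0 p : p != 0 -> 0 < dot_sum p p.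
Proof.
move=> p0; rewrite /dot_sum lt_def addr_ge0 ?dnorm_ge0// andbT.
rewrite paddr_eq0 ?dnorm_ge0// !dnorm_eq0; apply: contra p0.
by case: p => a b /= /andP[/eqP -> /eqP ->].
Qed.

HB.instance Definition _ := @bilinear_isBilinear.Build R[i]
  (V * V)%type (V * V)%type R[i] *%R (Num.conj \; *%R) dot_sum dot_sum_bilinear.
HB.instance Definition _ := @isHermitianSesquilinear.Build R[i]
  (V * V)%type false Num.conj dot_sum dot_sum_hermitian.
HB.instance Definition _ := @isDotProduct.Build R[i] (V * V)%type
  dot_sum dot_sum_gt0.

End orthogonal_sum.

(* An unbounded operator is represented by its graph. *)

Section regular_operators.
Context {R : realType} {H : completeNormedModType R[i]}.

Definition domain (A : set (H * H)) : set H := [set v | exists w, A (v, w)].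

Record regular_op := RegularOp {
  graph :> set (H * H) ;
  graph_linear : forall (a : R[i]) p q,
    graph p -> graph q -> graph (a *: p + q) ;
  graph_functional : forall v w w', graph (v, w) -> graph (v, w') -> w = w' ;
  graph_closed : closed graph ;
  graph_dense : dense (domain graph) }.

HB.instance Definition _ := gen_eqMixin regular_op.
HB.instance Definition _ := gen_choiceMixin regular_op.

Definition comp_graph (B A : set (H * H)) : set (H * H) :=
  [set p | exists z, A (p.1, z) /\ B (z, p.2)].

(* B + c *)
Definition shift_graph (B : set (H * H)) (c : R[i]) : set (H * H) :=
  [set p | B (p.1, p.2 - c *: p.1)].

(* T is everywhere defined and T = B^-1. *)
Definition is_inverse (B : set (H * H)) (T : H -> H) :=
  forall v w, B (v, w) <-> v = T w.

Variable dot : {dot H for Num.conj}.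

Definition adjoint_graph (A : set (H * H)) : set (H * H) :=
  [set p | forall q, A q -> dot q.2 p.1 = dot q.1 p.2].

Definition self_adjoint (A : set (H * H)) := adjoint_graph A = A.

Definition compact_op (T : H -> H) :=
  precompact [set T v | v in [set v : H | `|v| <= 1]].

Definition compact_resolvent (A : set (H * H)) :=
  exists K : bounded_op dot,
    is_inverse (shift_graph A 'i) K /\ compact_op K.

Record regular_sa_compact := RegularSaCompact {
  rsc_op :> regular_op ;
  rsc_self_adjoint : self_adjoint rsc_op ;
  rsc_compact_resolvent : compact_resolvent rsc_op }.

(* S = B^(-1/2): the positive square root of B^-1 *)
Definition is_inv_sqrt (B : set (H * H)) (S : bounded_op dot) :=
  positive_op dot S /\ is_inverse B (S \o S).

(* F = A (1 + A^* A)^(-1/2) *)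
Definition is_bounded_transform (A : set (H * H)) (F : bounded_op dot) :=
  exists2 S : bounded_op dot,
    is_inv_sqrt (shift_graph (comp_graph (adjoint_graph A) A) 1) S &
    forall v, A (S v, F v).

(* The default value is never used: the bounded transform of a regular operator
   exists and is unique, and so does the projection onto its graph. *)
Definition bounded_transform (A : regular_op) : bounded_op dot :=
  xget (zero_bop dot) [set F | is_bounded_transform A F].

Definition graph_projection (A : regular_op) : bounded_op (dot_sum dot) :=
  xget (zero_bop (dot_sum dot))
    [set P | orthogonal_projection (dot_sum dot) P /\ range P = A].

Definition riesz_space : topologicalType := initial_topology bounded_transform.
Definition graph_space : topologicalType := initial_topology graph_projection.

Definition riesz_continuous (X : topologicalType) (A : X -> regular_op) :=
  continuous (A : X -> riesz_space).

Definition graph_continuous (X : topologicalType) (A : X -> regular_op) :=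
  continuous (A : X -> graph_space).

(* E is the projection-valued measure with A = \int t dE(t): for each v, the
   measure mu = <E(.) v, v> satisfies v \in dom A <-> \int t^2 dmu < +oo, and
   <A v, v> = \int t dmu on dom A. By polarization this determines A. *)
Definition is_spectral_measure (A : set (H * H))
    (E : set (measurableTypeR R) -> bounded_op dot) :=
  [/\ forall S, measurable S -> orthogonal_projection dot (E S),
      forall v, E setT v = v,
      forall S T, measurable S -> measurable T ->
        forall v, E (S `&` T) v = E S (E T v) &
      forall v : H, exists mu : {measure set (measurableTypeR R) -> \bar R},
        [/\ forall S, measurable S -> mu S = (complex.Re (dot (E S v) v))%:E,
            domain A v <-> (\int[mu]_t ((t : R) ^+ 2)%:E < +oo)%E &
            forall w, A (v, w) -> dot w v = (\int[mu]_t (t : R))%:C]].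

(* Q is the value at A of the characteristic function of S. By the spectral
   theorem it exists and is unique for self-adjoint A and Borel S. *)
Definition is_spectral_projection (A : set (H * H)) (S : set R)
    (Q : bounded_op dot) :=
  exists2 E, is_spectral_measure A E & Q = E S.

Definition spectral_section (X : topologicalType) (A : X -> regular_op)
    (P : X -> bounded_op dot) :=
  [/\ continuous P,
      forall x, orthogonal_projection dot (P x) &
      exists r : X -> R, [/\ continuous r, forall x, 0 < r x &
        forall x, exists Q Q' : bounded_op dot,
          [/\ is_spectral_projection (A x) `[r x, +oo[ Q,
              is_spectral_projection (A x) `]- r x, +oo[ Q',
              le_op dot Q (P x) & le_op dot (P x) Q']]].

End regular_operators.

Definition separable (T : topologicalType) :=
  exists2 S : set T, countable S & dense S.

Definition infinite_dimensional (K : fieldType) (V : lmodType K) :=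
  forall (n : nat) (e : 'I_n -> V),
    exists v, forall c : 'I_n -> K, v <> \sum_i c i *: e i.

(* Main.v *)
Require Import Defs.
From mathcomp Require Import all_boot all_order all_algebra.
From mathcomp Require Import all_classical all_reals all_analysis.
From mathcomp Require Import measurable_realfun complex sesquilinear.
From mathcomp Require Import ring lra.

(** The bounded transform F of A satisfies F^2 = 1 - T with T = (1 + A^2)^-1, and T
    and B = A (1 + A^2)^-1 are blocks of the projection onto the graph of A, hence
    norm continuous in x; so are S = T^(1/2) and N = (1 - T)^(1/2) = |F|. Put
    K = F - (2 P - 1) N. Since 1_[r,oo)(A) <= P <= 1_(-r,oo)(A), the operator K
    vanishes on the spectral subspaces for [r, oo) and (-oo, -r], and on the
    remaining band 1 - T is at most q = rho^2 / (1 + rho^2) < 1 as soon as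
    r <= rho, so |K (1 - T)^n| <= 2 q^n. Therefore F is a locally uniform limit of
      F (1 - (1 - T)^n) + (2 P - 1) N (1 - T)^n,
    and this is norm continuous because F T = B S makes
    F (1 - (1 - T)^n) = B S (1 + (1 - T) + ... + (1 - T)^(n-1)). *)

Set Implicit Arguments.
Unset Strict Implicit.
Unset Printing Implicit Defensive.

Import Order.TTheory GRing.Theory Num.Theory.
Import numFieldNormedType.Exports.

Local Open Scope classical_set_scope.
Local Open Scope complex_scope.
Local Open Scope ring_scope.

(** The blocks [T] and [B] know F only through F^2 = 1 - T and F S = B. When A is unbounded, S has
    no bounded inverse, so F = B S^-1 need not inherit continuity: what the graph topology loses is
    the sign of F far out in the spectrum, where F is close to 1 or -1. The spectral section
    supplies this sign, since 2 P - 1 agrees with the sign of A outside a band. The two regimes are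
    glued by the weight (1 - T)^n rather than by a spectral cut-off. It is a polynomial in T, hence
    norm continuous without any functional calculus. Its complement is divisible by T = S^2, so that
    one factor S can be absorbed by F. Square roots are likewise limits of polynomials, at a rate
    that is the same for all operators involved. Spectral measures are given by quadratic forms
    only. Hence it has to be shown that spectral projections reduce A, that F is |F| times the sign
    of A, and that 1 - T contracts on the band; these use graph membership, symmetry and uniqueness
    of positive roots. *)

Section real_inner_product.
Context {R : realType} {V : lmodType R[i]} (d : {dot V for Num.conj}).
Implicit Types (u v w : V) (t : R).
Local Notation nrm := (ipnorm d).

(** With real values the estimates are within reach of [lra] and [nra]; complex identities are
    recovered from the pairs u and i u by [dot_eq]. *)
Definition rdot u v : R := complex.Re (d u v).

Lemma rdotDl u v w : rdot (u + v) w = rdot u w + rdot v w.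
Proof. by rewrite /rdot linearDl raddfD. Qed.

Lemma dotC u v : d u v = (d v u)^*.
Proof. by rewrite hermC expr0 mul1r. Qed.

Lemma rdotC u v : rdot u v = rdot v u.
Proof. by rewrite /rdot dotC; case: (d v u). Qed.

Lemma rdotZl t u v : rdot (t%:C *: u) v = t * rdot u v.
Proof.
by rewrite /rdot linearZl_LR /=; case: (d u v) => a b /=; rewrite mul0r subr0.
Qed.

Lemma rdotDr u v w : rdot u (v + w) = rdot u v + rdot u w.
Proof. by rewrite rdotC rdotDl !(rdotC u). Qed.

Lemma rdotZr t u v : rdot u (t%:C *: v) = t * rdot u v.
Proof. by rewrite rdotC rdotZl rdotC. Qed.

Lemma rdotNl u v : rdot (- u) v = - rdot u v.
Proof. by rewrite /rdot linearNl raddfN. Qed.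

Lemma rdotNr u v : rdot u (- v) = - rdot u v.
Proof. by rewrite rdotC rdotNl rdotC. Qed.

Definition rdotE := (rdotDl, rdotDr, rdotNl, rdotNr, rdotZl, rdotZr).

Lemma rdot_nrm u : rdot u u = nrm u ^+ 2.
Proof. by rewrite ipnorm_sqr. Qed.

Lemma rdot_ge0 u : 0 <= rdot u u.
Proof. by rewrite rdot_nrm sqr_ge0. Qed.

Lemma rdot0l u : rdot 0 u = 0.
Proof. by rewrite -(subrr u) !rdotE subrr. Qed.

Lemma rdot0r u : rdot u 0 = 0.
Proof. by rewrite rdotC rdot0l. Qed.

Lemma rdot_eq0 u : rdot u u = 0 -> u = 0.
Proof.
by move=> u0; apply: (@ipnorm_eq0 _ _ d); apply/eqP; rewrite -sqrf_eq0 -rdot_nrm u0.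
Qed.

(** Reduces an identity between real combinations of vectors to a scalar identity, which [ring] or
    [field] settles. *)
Lemma rdot_ext u v : (forall w, rdot u w = rdot v w) -> u = v.
Proof.
move=> uv; apply/eqP; rewrite -subr_eq0; apply/eqP/rdot_eq0.
by rewrite rdotDl rdotNl uv subrr.
Qed.

Lemma rdotI u v : rdot ('i *: u) v = - complex.Im (d u v).
Proof.
rewrite /rdot linearZl_LR /=; case: (d u v) => a b /=.
by rewrite mul0r mul1r sub0r.
Qed.

Lemma dot_eq u v w z : rdot u v = rdot w z ->
  rdot ('i *: u) v = rdot ('i *: w) z -> d u v = d w z.
Proof.
rewrite !rdotI /rdot; case: (d u v) => a b; case: (d w z) => a' b' /= -> /oppr_inj.
by move=> ->.
Qed.

Lemma rdotIl u v : rdot ('i *: u) v = - rdot u ('i *: v).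
Proof. by rewrite (rdotC u) !rdotI (dotC v u); case: (d u v) => a b /=; rewrite !opprK. Qed.

Lemma ipnormDB u v :
  nrm (u + v) ^+ 2 + nrm (u - v) ^+ 2 = 2 * (nrm u ^+ 2 + nrm v ^+ 2).
Proof. by rewrite -!rdot_nrm !rdotE (rdotC v u); ring. Qed.

Lemma ipnormD_sqr u v : nrm (u + v) ^+ 2 = nrm u ^+ 2 + nrm v ^+ 2 + 2 * rdot u v.
Proof. by rewrite -!rdot_nrm !rdotE (rdotC v u); ring. Qed.

Lemma rdot_le u v : rdot u v <= nrm u * nrm v.
Proof.
have := ipnormD d u v; have := ipnorm_ge0 d (u + v).
have := ipnorm_ge0 d u; have := ipnorm_ge0 d v.
by have := ipnormD_sqr u v; nra.
Qed.

Lemma ipnormZr t u : nrm (t%:C *: u) = `|t| * nrm u.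
Proof. by rewrite ipnormZ normc_def /= expr0n addr0 sqrtr_sqr. Qed.

Lemma ipnormB u v : nrm (u - v) = nrm (v - u).
Proof. by rewrite -ipnormN opprB. Qed.

Lemma ipnorm_trig u v w : nrm (u - w) <= nrm (u - v) + nrm (v - w).
Proof. by rewrite -(subrK v u) -addrA (le_trans (ipnormD _ _ _))// subrK. Qed.

Lemma ipnorm_le_add u v : nrm u <= nrm (u - v) + nrm v.
Proof. by rewrite -{1}(subrK v u) ipnormD. Qed.

Definition rsym (f : V -> V) := forall u v, rdot (f u) v = rdot u (f v).

Lemma rsym_dot (f : {linear V -> V}) : rsym f -> forall u v, d (f u) v = d u (f v).
Proof. by move=> sf u v; apply: dot_eq => //; rewrite -linearZ /= sf. Qed.

(** A positive form has real values. That its value at i v + u is real says that the real parts of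
    the two cross terms agree. *)
Lemma positive_rsym (f : {linear V -> V}) : positive_op d f -> rsym f.
Proof.
move=> pf u v.
have im0 w : complex.Im (d (f w) w) = 0 by rewrite ger0_Im// pf.
have := im0 ('i *: v + u); have := im0 u; have := im0 v; rewrite /rdot.
rewrite (linearP f) !linearDl !linearDr !linearZl_LR /= !linearZr_LR /=.
rewrite (dotC u).
case: (d (f v) v) (d (f u) u) (d (f u) v) (d (f v) u) => a b [a' b'] [e g] [e' g'] /=.
by move=> -> ->; rewrite !(mul0r, mul1r, mulr0, add0r, addr0, oppr0, subr0); lra.
Qed.

Lemma rsym_positive (f : {linear V -> V}) :
  rsym f -> (forall v, 0 <= rdot (f v) v) -> positive_op d f.
Proof.
move=> sf pf v; rewrite lecE /= pf andbT; apply/eqP.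
have := rsym_dot sf v v; rewrite [RHS]dotC.
by case: (d (f v) v) => a b /= [] ?; lra.
Qed.

Lemma positive_rdot (f : V -> V) : positive_op d f -> forall v, 0 <= rdot (f v) v.
Proof. by move=> pf v; have := pf v; rewrite lecE /= => /andP[]. Qed.

(* w minimizes the form v |-> <f v, v>, whose gradient at w is 2 (f w). *)
Lemma rsym_ker (f : {linear V -> V}) : rsym f -> (forall v, 0 <= rdot (f v) v) ->
  forall w, rdot (f w) w = 0 -> f w = 0.
Proof.
move=> sf pf w w0; apply: rdot_eq0; apply/eqP; rewrite eq_le rdot_ge0 andbT.
set s := rdot (f w) (f w).
set k := rdot (f (f w)) (f w).
have k0 : 0 <= k := pf _.
have s0 : 0 <= s := rdot_ge0 _.
(* Close to the optimal step s / k of the descent from w along - f w; the added 1 covers k = 0. The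
   form becomes - t^2 (k + 2), which forces t = 0. *)
pose t := s / (k + 1).
have := pf ((- t)%:C *: f w + w).
rewrite (linearP f) !rdotE -/k (sf (f w) w) -/s w0 => h.
have e : t * (k + 1) = s by rewrite /t; field; lra.
by nra.
Qed.

(** Commutation factors f^2 - g^2, so w = f v - g v satisfies f w + g w = 0. Both forms are
    nonnegative, hence f w = g w = 0, and then <w, w> = <(f - g) w, v> = 0. *)
Lemma positive_sqrt_unique (f g : {linear V -> V}) :
  rsym f -> (forall v, 0 <= rdot (f v) v) ->
  rsym g -> (forall v, 0 <= rdot (g v) v) ->
  (forall v, f (g v) = g (f v)) -> (forall v, f (f v) = g (g v)) ->
  forall v, f v = g v.
Proof.
move=> sf pf sg pg fg ff v; apply/eqP; rewrite -subr_eq0; apply/eqP.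
set w := f v - g v.
have e : f w + g w = 0.
  by rewrite /w !linearB /= fg ff addrA subrK subrr.
have : rdot (f w) w + rdot (g w) w = 0 by rewrite -rdotDl e rdot0l.
have := pf w; have := pg w => g0 f0 h.
have fw0 : f w = 0 by apply: rsym_ker => //; lra.
have gw0 : g w = 0 by apply: rsym_ker => //; lra.
by apply: rdot_eq0; rewrite {2}/w rdotDr rdotNr -sf -sg fw0 gw0 rdot0l subrr.
Qed.

End real_inner_product.

Section bounded_op_linear.
Context {R : realType} {V : lmodType R[i]} (d : {dot V for Num.conj}).
Variable S : bounded_op d.

Lemma bop0 : S 0 = 0. Proof. exact: linear0. Qed.

Lemma bopD u v : S (u + v) = S u + S v. Proof. exact: linearD. Qed.

Lemma bopB u v : S (u - v) = S u - S v. Proof. exact: linearB. Qed.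

Lemma bopN v : S (- v) = - S v. Proof. exact: linearN. Qed.

Lemma bopZ a v : S (a *: v) = a *: S v. Proof. exact: linearZ. Qed.

End bounded_op_linear.

(** * Orthogonal projections *)

Lemma invn_le {R : realType} (e : R) : 0 < e ->
  exists N, forall n, (N <= n)%N -> n.+1%:R^-1 <= e.
Proof.
move=> e0; have [N _ h] := near_infty_natSinv_lt (PosNum e0).
by exists N => n Nn; rewrite ltW//; exact: h.
Qed.

Section orthogonal_projection_theorem.
Context {R : realType} {V : lmodType R[i]} (d : {dot V for Num.conj}).
Implicit Types (u : nat -> V) (v w : V) (G : set V).
Local Notation nrm := (ipnorm d).

Definition ip_cauchy u := forall e : R, 0 < e ->
  exists N, forall m n, (N <= m)%N -> (N <= n)%N -> nrm (u m - u n) <= e.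

Definition ip_cvg u v := forall e : R, 0 < e ->
  exists N, forall n, (N <= n)%N -> nrm (u n - v) <= e.

(** Relative to the norm of [d] and to a subset, because it is applied to a graph inside [H * H]
    with the norm of [dot_sum], which is not the norm that the product carries. *)
Definition ip_complete G := forall u, (forall n, G (u n)) -> ip_cauchy u ->
  exists2 v, G v & ip_cvg u v.

Definition linear_set G := G 0 /\ forall (a : R[i]) v w, G v -> G w -> G (a *: v + w).

Lemma linear_setP G v w : linear_set G -> G v -> G w -> forall a, G (a *: v + w).
Proof. by move=> [_ h] gv gw a; exact: h. Qed.

Lemma linear_setZ G a v : linear_set G -> G v -> G (a *: v).
Proof. by move=> [h0 h] gv; rewrite -[_ *: _]addr0; exact: h. Qed.

Lemma linear_setB G v w : linear_set G -> G v -> G w -> G (v - w).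
Proof. by move=> [h0 h] gv gw; rewrite addrC -scaleN1r; exact: h. Qed.

Lemma nearest_point G v : linear_set G -> ip_complete G ->
  exists2 p, G p & forall g, G g -> nrm (v - p) <= nrm (v - g).
Proof.
move=> lG cG.
pose D := [set nrm (v - g) | g in G].
have hD : has_inf D.
  split; first by exists (nrm (v - 0)), 0 => //; exact: lG.1.
  by exists 0 => _ [g _ <-]; exact: ipnorm_ge0.
pose s := inf D.
have s_le g : G g -> s <= nrm (v - g) by move=> Gg; apply: ge_inf => //; [exact: hD.2|exists g].
have s0 : 0 <= s by apply: lb_le_inf; [exact: hD.1|move=> _ [g _ <-]; exact: ipnorm_ge0].
have /choice[u hu] (n : nat) : exists g, G g /\ nrm (v - g) < s + n.+1%:R^-1.
  have [//|_ [g Gg <-] h] := @inf_adherent _ D n.+1%:R^-1 _ hD.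
  by exists g.
clearbody s.
have [//|p Gp up] := cG u (fun n => (hu n).1).
  move=> e e0.
  have s4 : 0 < 8 * s + 4 by lra.
  (* The parallelogram identity will bound |u m - u n|^2 by 4 (s + k)^2 - 4 s^2 = 8 s k + 4 k^2;
     with k <= 1 this is at most k (8 s + 4) <= e^2. *)
  pose k := Order.min 1 (e ^+ 2 / (8 * s + 4)).
  have k0 : 0 < k by rewrite lt_min ltr01/= divr_gt0 ?exprn_gt0.
  have k1 : k <= 1 by rewrite ge_min lexx.
  have ks : k * (8 * s + 4) <= e ^+ 2.
    by rewrite -ler_pdivlMr// ge_min lexx orbT.
  clearbody k.
  have [N hN] := invn_le k0.
  have close n : (N <= n)%N -> nrm (v - u n) <= s + k.
    by move=> /hN h; rewrite ltW// (lt_le_trans (hu n).2)// lerD2l.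
  exists N => m n Nm Nn.
  rewrite -(ler_pXn2r (n := 2)) ?nnegrE ?ipnorm_ge0 ?(ltW e0)//.
  have := ipnormDB d (v - u m) (v - u n).
  have -> : v - u m - (v - u n) = u n - u m by rewrite addrC opprB addrA subrK.
  rewrite (ipnormB d (u n)).
  have -> : v - u m + (v - u n) = 2%:C *: (v - ((2^-1)%:C *: (u m) + (2^-1)%:C *: u n)).
    by apply: (@rdot_ext _ _ d) => w; rewrite !rdotE; field.
  rewrite ipnormZr ger0_norm//.
  have : s <= nrm (v - ((2^-1)%:C *: (u m) + (2^-1)%:C *: u n)).
    apply: s_le; apply: linear_setP => //; first exact: (hu m).1.
    by apply: linear_setZ => //; exact: (hu n).1.
  have := close _ Nm; have := close _ Nn.
  have := ipnorm_ge0 d (v - u m); have := ipnorm_ge0 d (v - u n).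
  set x := nrm (v - u m); set y := nrm (v - u n); set z := nrm (v - (_ + _)).
  move=> y0 x0 yk xk sz.
  have : x ^+ 2 <= (s + k) ^+ 2 by rewrite ler_pXn2r ?nnegrE//; lra.
  have : y ^+ 2 <= (s + k) ^+ 2 by rewrite ler_pXn2r ?nnegrE//; lra.
  have : s ^+ 2 <= z ^+ 2 by rewrite ler_pXn2r ?nnegrE//; lra.
  have : k ^+ 2 <= k by rewrite expr2 ler_piMl//; lra.
  by nra.
exists p => // g Gg; apply: le_trans (s_le _ Gg).
apply/ler_addgt0Pr => e e0.
have e20 : 0 < e / 2 by lra.
have [N1 h1] := up _ e20; have [N2 h2] := invn_le e20.
set n := maxn N1 N2.
have := h1 n (leq_maxl _ _); have := lt_le_trans (hu n).2 (lerD (lexx s) (h2 n (leq_maxr _ _))).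
have := ipnorm_trig d v (u n) p.
lra.
Qed.

Lemma orthogonal_decomposition G v : linear_set G -> ip_complete G ->
  exists2 p, G p & forall g, G g -> rdot d (v - p) g = 0.
Proof.
move=> lG cG; have [p Gp hp] := nearest_point v lG cG; exists p => // g Gg.
set c := rdot _ _ _; set k := nrm g ^+ 2.
have k0 : 0 <= k := sqr_ge0 _.
have h t : 0 <= - 2 * t * c + t ^+ 2 * k.
  have := hp (t%:C *: g + p) (linear_setP lG Gg Gp _).
  rewrite -(ler_pXn2r (n := 2)) ?nnegrE ?ipnorm_ge0//.
  have -> : v - (t%:C *: g + p) = (- t)%:C *: g + (v - p).
    by apply: (@rdot_ext _ _ d) => w; rewrite !rdotE; ring.
  by rewrite [X in _ <= X]ipnorm_combE -/(rdot _ _ _) rdotC -/c -/k; nra.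
(* First variation: at t = c / (k + 1) the inequality [h] reads 0 <= - t^2 (k + 2), so t and c
   vanish. The added 1 covers g = 0. *)
have e : c / (k + 1) * (k + 1) = c by field; lra.
have := h (c / (k + 1)); set t := c / (k + 1) in e *; clearbody t; rewrite -e.
move=> h1; have : t ^+ 2 * (k + 2) <= 0 by nra.
rewrite pmulr_lle0; last by lra.
move=> t0; have /eqP : t ^+ 2 = 0 by apply/eqP; rewrite eq_le t0 sqr_ge0.
by rewrite sqrf_eq0 => /eqP ->; rewrite mul0r.
Qed.

Lemma orthogonal_complex G v : linear_set G ->
  (forall g, G g -> rdot d v g = 0) -> forall g, G g -> d v g = 0.
Proof.
move=> lG h g Gg; rewrite -[RHS](linear0l d g); apply: dot_eq.
  by rewrite h// rdot0l.
by rewrite scaler0 rdot0l rdotIl h ?oppr0//; exact: linear_setZ.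
Qed.

(** The point of [G] whose difference to v is orthogonal to [G] is unique; linearity and idempotence
    both come from this uniqueness, boundedness from Pythagoras. *)
Lemma exists_projection G : linear_set G -> ip_complete G ->
  exists P : bounded_op d, orthogonal_projection d P /\ range P = G.
Proof.
move=> lG cG.
have /choice[P hP] v : exists p, G p /\ forall g, G g -> rdot d (v - p) g = 0.
  by have [p] := orthogonal_decomposition v lG cG; exists p.
have uP v p : G p -> (forall g, G g -> rdot d (v - p) g = 0) -> P v = p.
  move=> Gp h; apply/eqP; rewrite -subr_eq0; apply/eqP/(@rdot_eq0 _ _ d).
  have -> : P v - p = (v - p) - (v - P v) by rewrite [RHS]addrC opprB addrA subrK.
  have Gg : G ((v - p) - (v - P v)).
    rewrite opprB addrC addrA subrK.
    by apply: linear_setB => //; exact: (hP v).1.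
  by rewrite {1}rdotDl rdotNl h// (hP v).2// subrr.
have lP a (w v : V) : P (a *: w + v) = a *: P w + P v.
  apply: uP; first by apply: linear_setP; [|exact: (hP w).1|exact: (hP v).1].
  move=> g Gg; have -> : a *: w + v - (a *: P w + P v) = a *: (w - P w) + (v - P v).
    by rewrite scalerBr addrACA opprD.
  rewrite rdotDl (hP v).2// /rdot linearZl_LR /=.
  by rewrite (orthogonal_complex lG (hP w).2)// mulr0 addr0.
have PP v : nrm v ^+ 2 = nrm (P v) ^+ 2 + nrm (v - P v) ^+ 2.
  have := ipnormD_sqr d (v - P v) (P v).
  by rewrite subrK (hP v).2; [rewrite mulr0 addr0 addrC|exact: (hP v).1].
have bP : exists M : R, forall v, nrm (P v) <= M * nrm v.
  exists 1 => v; rewrite mul1r -(ler_pXn2r (n := 2)) ?nnegrE ?ipnorm_ge0//.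
  by rewrite (PP v) lerDl sqr_ge0.
have PG g : G g -> P g = g.
  by move=> Gg; apply: uP => // h _; rewrite subrr rdot0l.
exists (BoundedOp lP bP); split; last first.
  by apply/seteqP; split=> [_ [v _ <-]|g Gg] /=; [exact: (hP v).1|exists g => //; exact: PG].
split => [v /=|]; first by rewrite PG//; exact: (hP v).1.
apply: (rsym_dot (f := BoundedOp lP bP)) => w v /=.
have := (hP v).2 _ (hP w).1; have := (hP w).2 _ (hP v).1.
by rewrite !rdotE (rdotC d v) (rdotC d (P v)); lra.
Qed.

End orthogonal_projection_theorem.

(** * Square roots of positive operators *)

Section square_root.
Context {R : realType} {V : lmodType R[i]} (d : {dot V for Num.conj}).
Implicit Types (u v w : V) (f C : V -> V).
Local Notation nrm := (ipnorm d).

(* The iteration Y := (C + Y^2) / 2 for 1 - sqrt (1 - C), and its scalar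
   majorant, which solves the same recurrence with C replaced by 1. *)
Fixpoint sqrt_iter C n v : V :=
  if n is k.+1 then (2^-1)%:C *: (C v + sqrt_iter C k (sqrt_iter C k v)) else 0.

Fixpoint sqrt_maj n : R :=
  if n is k.+1 then 2^-1 * (1 + sqrt_maj k * sqrt_maj k) else 0.

Lemma sqrt_maj_ge0 n : 0 <= sqrt_maj n.
Proof. by elim: n => [|n IH] //=; nra. Qed.

Lemma sqrt_maj_le1 n : sqrt_maj n <= 1.
Proof. by elim: n => [|n IH] /=; [exact: ler01|have := sqrt_maj_ge0 n; nra]. Qed.

Lemma sqrt_majS n : sqrt_maj n <= sqrt_maj n.+1.
Proof. by have := sqr_ge0 (sqrt_maj n - 1) => /=; nra. Qed.

Lemma sqrt_maj_le m n : (n <= m)%N -> sqrt_maj n <= sqrt_maj m.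
Proof.
move=> /subnK <-; elim: (m - n)%N => // k IH; rewrite addSn.
exact: le_trans IH (sqrt_majS _).
Qed.

(** The gap g = 1 - [sqrt_maj n] obeys g' = g - g^2 / 2, whose solutions decay like 2 / n. In the
    induction z = g (k + 2) <= 2, and z (k + 2) - z^2 / 2 increases in z up to z = 2. *)
Lemma sqrt_maj_lim n : (1 - sqrt_maj n) * (n%:R + 2) <= 2.
Proof.
elim: n => [|n IH]; first by rewrite /=; lra.
have := sqrt_maj_ge0 n; have := sqrt_maj_le1 n; move: IH.
rewrite -[n.+1%:R]natr1 [sqrt_maj n.+1]/=.
have : 0 <= n%:R :> R by exact: ler0n.
move: (n%:R : R) (sqrt_maj n) => k e k0 IH e1 e0.
pose z := (1 - e) * (k + 2).
have z2 : z <= 2 by [].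
have z0 : 0 <= z by rewrite /z mulr_ge0//; lra.
have h1 : z * (k + 2) - z ^+ 2 / 2 <= 2 * (k + 1) by clearbody z; nra.
have h2 : (z * (k + 2) - z ^+ 2 / 2) * (k + 3) <= 2 * (k + 2) ^+ 2.
  apply: (@le_trans _ _ (2 * (k + 1) * (k + 3))); last by nra.
  by rewrite ler_wpM2r//; lra.
rewrite -(ler_pM2r (_ : 0 < (k + 2) ^+ 2)); last by rewrite exprn_gt0//; lra.
by apply: le_trans h2; rewrite /z le_eqVlt; apply/orP; left; apply/eqP; field.
Qed.

Lemma sqrt_maj_small (t M : R) : (forall n, t <= (1 - sqrt_maj n) * M) -> t <= 0.
Proof.
move=> h; have M0 : 0 <= `|M| := normr_ge0 M.
have {}h n : t * (n%:R + 2) <= 2 * `|M|.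
  apply: (@le_trans _ _ ((1 - sqrt_maj n) * (n%:R + 2) * `|M|)); last first.
    by rewrite ler_wpM2r// sqrt_maj_lim.
  rewrite mulrAC ler_wpM2r ?addr_ge0// (le_trans (h n))// ler_wpM2l ?ler_norm//.
  by rewrite subr_ge0 sqrt_maj_le1.
rewrite leNgt; apply/negP => t0.
have := h (Num.bound (2 * `|M| / t)).
have := archi_boundP (divr_ge0 (mulr_ge0 (ler0n R 2) M0) (ltW t0)).
by rewrite ltr_pdivrMr//; set b := (_%:R : R); nra.
Qed.

(** Replaces passage to the limit: an identity for the limit of the iteration follows once its two
    sides differ by at most a fixed multiple of the gap. *)
Lemma sqrt_maj_eq u v (M : R) :
  (forall n, nrm (u - v) <= (1 - sqrt_maj n) * M) -> u = v.
Proof.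
move=> h; apply/eqP; rewrite -subr_eq0; apply/eqP/(@ipnorm_eq0 _ _ d)/eqP.
by rewrite eq_le ipnorm_ge0 (sqrt_maj_small h).
Qed.

(* S is the positive square root of 1 - C. The rate of convergence of the iteration
   is the same for all C, whence the continuity of S in C. *)
Definition is_sqrt_compl (C S : bounded_op d) :=
  [/\ rsym d S /\ (forall v, 0 <= rdot d (S v) v),
      forall v, S (S v) = v - C v,
      forall v, nrm (v - S v) <= nrm v,
      forall n v, nrm (sqrt_iter C n v - (v - S v)) <= (1 - sqrt_maj n) * nrm v &
      forall f : bounded_op d, (forall v, f (C v) = C (f v)) ->
        forall v, f (S v) = S (f v)].

Section iteration.
Variable C : bounded_op d.
Hypothesis symC : rsym d C.
Hypothesis normC : forall v, nrm (C v) <= nrm v.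
Local Notation Y := (sqrt_iter C).

Lemma sqrt_iter_linear n (a : R[i]) u v : Y n (a *: u + v) = a *: Y n u + Y n v.
Proof.
elim: n u v => [|n IH] u v /=; first by rewrite scaler0 addr0.
rewrite (linearP C) !IH !scalerDr !scalerA !(mulrC _ a) -!scalerA.
by rewrite addrACA.
Qed.

Lemma sqrt_iterB n u v : Y n (u - v) = Y n u - Y n v.
Proof. by rewrite addrC -scaleN1r sqrt_iter_linear scaleN1r addrC. Qed.

Lemma sqrt_iter_norm n v : nrm (Y n v) <= sqrt_maj n * nrm v.
Proof.
elim: n v => [|n IH] v /=; first by rewrite ipnorm0 mul0r.
rewrite ipnormZr ger0_norm ?invr_ge0// -mulrA ler_wpM2l ?invr_ge0//.
rewrite mulrDl mul1r (le_trans (ipnormD _ _ _))// lerD//.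
by rewrite (le_trans (IH _))// -mulrA ler_wpM2l// sqrt_maj_ge0.
Qed.

(** The splitting Y^2 - Z^2 = Y (Y - Z) + (Y - Z) Z needs no commutation, and for the scalar
    majorant the resulting bound is an equality. *)
Lemma sqrt_iterS n v :
  nrm (Y n.+1 v - Y n v) <= (sqrt_maj n.+1 - sqrt_maj n) * nrm v.
Proof.
elim: n v => [|n IH] v.
  by rewrite /= !subr0 addr0 mul0r addr0 mulr1 ipnormZr ger0_norm ?invr_ge0//
    ler_wpM2l ?invr_ge0.
have -> : Y n.+2 v - Y n.+1 v =
    (2^-1)%:C *: (Y n.+1 (Y n.+1 v - Y n v) + (Y n.+1 (Y n v) - Y n (Y n v))).
  rewrite sqrt_iterB [RHS]/= -/(Y n.+1 _) addrA subrK /= -scalerBr; congr (_ *: _).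
  by rewrite opprD addrACA subrr add0r.
rewrite ipnormZr ger0_norm ?invr_ge0//.
have h1 := sqrt_iter_norm n.+1 (Y n.+1 v - Y n v).
have h2 := IH (Y n v); have h3 := IH v; have h4 := sqrt_iter_norm n v.
have h5 := sqrt_maj_ge0 n.+1; have h6 := sqrt_majS n.
have h7 := ler_wpM2l h5 h3.
have h8 : (sqrt_maj n.+1 - sqrt_maj n) * nrm (Y n v) <=
   (sqrt_maj n.+1 - sqrt_maj n) * (sqrt_maj n * nrm v) by rewrite ler_wpM2l ?subr_ge0.
have h9 := ipnormD d (Y n.+1 (Y n.+1 v - Y n v)) (Y n.+1 (Y n v) - Y n (Y n v)).
have -> : (sqrt_maj n.+2 - sqrt_maj n.+1) =
   2^-1 * ((sqrt_maj n.+1 + sqrt_maj n) * (sqrt_maj n.+1 - sqrt_maj n)).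
  by rewrite [sqrt_maj n.+2]/= [X in _ - X]/=; rewrite [sqrt_maj n.+1]/=; field.
rewrite -mulrA ler_wpM2l ?invr_ge0//.
by lra.
Qed.

Lemma sqrt_iter_cauchy m n v : (n <= m)%N ->
  nrm (Y m v - Y n v) <= (sqrt_maj m - sqrt_maj n) * nrm v.
Proof.
move=> /subnK <-; elim: (m - n)%N => [|k IH].
  by rewrite !subrr ipnorm0 mul0r.
rewrite addSn (le_trans (ipnorm_trig _ _ (Y (k + n) v) _))//.
by have := sqrt_iterS (k + n) v; lra.
Qed.

Lemma sqrt_iter_sym n : rsym d (Y n).
Proof.
elim: n => [|n IH] u v; first by rewrite /= rdot0l rdot0r.
by rewrite /= !rdotE symC !IH.
Qed.

Lemma sqrt_iter_comm (f : {linear V -> V}) n :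
  (forall v, f (C v) = C (f v)) -> forall v, f (Y n v) = Y n (f v).
Proof.
move=> fC; elim: n => [|n IH] v; first by rewrite /= linear0.
by rewrite /= linearZ /= linearD /= fC !IH.
Qed.

Hypothesis completeV : ip_complete d [set: V].

Lemma sqrt_iter_lim v : exists l, forall n, nrm (Y n v - l) <= (1 - sqrt_maj n) * nrm v.
Proof.
have [//||l _ hl] := @completeV (fun n => Y n v).
  move=> e e0.
  have : 0 < e / (nrm v + 1) by rewrite divr_gt0// ltr_wpDl ?ipnorm_ge0.
  move: (ipnorm_ge0 d v) => v0 h.
  have [N hN] : exists N, (1 - sqrt_maj N) * (nrm v + 1) <= e.
    apply: contrapT => /forallNP H.
    suff : e <= 0 by lra.
    apply: (@sqrt_maj_small _ (nrm v + 1)) => n; apply/ltW.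
    by rewrite ltNge; apply/negP/H.
  have close m n : (N <= n)%N -> (n <= m)%N -> nrm (Y m v - Y n v) <= e.
    move=> Nn nm; apply: le_trans (sqrt_iter_cauchy v nm) _.
    have := sqrt_maj_le1 m; have := sqrt_maj_le Nn; have := sqrt_maj_le1 N; nra.
  exists N => m n Nm Nn; have [nm|/ltnW mn] := leqP n m; first exact: close.
  by rewrite ipnormB close.
exists l => n; apply/ler_addgt0Pr => e e0.
have [N hN] := hl _ e0.
apply: le_trans (ipnorm_trig _ _ (Y (maxn n N) v) _) _.
apply: lerD; last by apply: hN; exact: leq_maxr.
rewrite ipnormB (le_trans (sqrt_iter_cauchy v (leq_maxl _ _)))//.
by rewrite ler_wpM2r ?ipnorm_ge0// lerB// sqrt_maj_le1.
Qed.

Lemma exists_sqrt : exists S : bounded_op d, is_sqrt_compl C S.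
Proof.
have /choice[L hL] := sqrt_iter_lim.
have LY n v : nrm (L v - Y n v) <= (1 - sqrt_maj n) * nrm v by rewrite ipnormB.
have y1 n : 0 <= 1 - sqrt_maj n by rewrite subr_ge0 sqrt_maj_le1.
have linL a u v : L (a *: u + v) = a *: L u + L v.
  apply: (@sqrt_maj_eq _ _ (nrm (a *: u + v) + complex.Re `|a| * nrm u + nrm v)) => n.
  have -> : L (a *: u + v) - (a *: L u + L v) =
     (L (a *: u + v) - Y n (a *: u + v)) + a *: (Y n u - L u) + (Y n v - L v).
    rewrite sqrt_iter_linear scalerBr; apply: (@rdot_ext _ _ d) => w.
    by rewrite !rdotE; ring.
  have a0 : 0 <= complex.Re `|a| by rewrite normc_def /= sqrtr_ge0.
  have h1 := LY n (a *: u + v); have h2 := ler_wpM2l a0 (hL u n); have h3 := hL v n.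
  rewrite (le_trans (ipnormD _ _ _))// !mulrDr lerD// (le_trans (ipnormD _ _ _))// lerD//.
  by rewrite ipnormZ mulrCA.
have normL v : nrm (L v) <= nrm v.
  rewrite -subr_le0; apply: (@sqrt_maj_small _ (nrm v)) => n.
  have := ipnorm_le_add d (L v) (Y n v); have := LY n v; have := sqrt_iter_norm n v.
  by have := sqrt_maj_le1 n; have := ipnorm_ge0 d v; nra.
have linS a u v : (a *: u + v) - L (a *: u + v) = a *: (u - L u) + (v - L v).
  by rewrite linL scalerBr opprD addrACA.
have bS : exists M : R, forall v, nrm (v - L v) <= M * nrm v.
  by exists 2 => v; rewrite mulr_natl mulr2n (le_trans (ipnormD _ _ _))// ipnormN lerD.
have symL : rsym d L.
  move=> u v; apply/eqP; rewrite -subr_eq0 -normr_le0.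
  apply: (@sqrt_maj_small _ (2 * (nrm u * nrm v))) => n.
  have -> : rdot d (L u) v - rdot d u (L v) =
      rdot d (L u - Y n u) v - rdot d u (L v - Y n v).
    by rewrite !rdotE sqrt_iter_sym; ring.
  have h1 := rdot_le d (L u - Y n u) v; have h2 := rdot_le d (- (L u - Y n u)) v.
  have h3 := rdot_le d u (L v - Y n v); have h4 := rdot_le d u (- (L v - Y n v)).
  have h5 := ler_wpM2r (ipnorm_ge0 d v) (LY n u).
  have h6 := ler_wpM2l (ipnorm_ge0 d u) (LY n v).
  move: h1 h2 h3 h4; rewrite rdotNl rdotNr !ipnormN => h1 h2 h3 h4.
  by rewrite ler_norml; apply/andP; split; lra.
(* The fixed point equation of the iteration; it says (1 - L)^2 = 1 - C. *)
have LL v : L v + L v = C v + L (L v).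
  apply: (@sqrt_maj_eq _ _ (4 * nrm v)) => n.
  have -> : L v + L v - (C v + L (L v)) =
     2%:C *: (L v - Y n.+1 v) + ((Y n (Y n v - L v)) + (Y n (L v) - L (L v))).
    rewrite sqrt_iterB; apply: (@rdot_ext _ _ d) => w.
    by rewrite /= !rdotE; field.
  rewrite (le_trans (ipnormD _ _ _))// ipnormZr ger0_norm//.
  have h1 := ipnormD d (Y n (Y n v - L v)) (Y n (L v) - L (L v)).
  have h2 := sqrt_iter_norm n (Y n v - L v); have h3 := hL v n.
  have h4 := hL (L v) n; have h5 := LY n.+1 v; have h6 := ler_wpM2l (y1 n) (normL v).
  have h7 := sqrt_majS n; have h8 := ler_wpM2r (ipnorm_ge0 d (Y n v - L v)) (sqrt_maj_le1 n).
  have h9 := ler_wpM2r (ipnorm_ge0 d v) h7.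
  by lra.
exists (BoundedOp linS bS); split => /=.
- split=> [u v|v]; first by rewrite !rdotE symL.
  rewrite rdotDl rdotNl rdot_nrm subr_ge0 (le_trans (rdot_le _ _ _))//.
  by rewrite expr2 ler_wpM2r ?ipnorm_ge0.
- move=> v; have -> : L (v - L v) = L v - L (L v).
    by rewrite addrC -scaleN1r linL scaleN1r addrC.
  have -> : C v = L v + L v - L (L v) by rewrite LL addrK.
  by apply: (@rdot_ext _ _ d) => w; rewrite !rdotE; ring.
- by move=> v; rewrite subKr.
- by move=> n v; rewrite subKr.
- move=> f fC v; rewrite linearB /=; congr (_ - _).
  have [M hM] := bop_bounded f.
  apply: (@sqrt_maj_eq _ _ (`|M| * nrm v + nrm (f v))) => n.
  have -> : f (L v) - L (f v) = f (L v - Y n v) + (Y n (f v) - L (f v)).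
    by rewrite linearB /= sqrt_iter_comm// addrA subrK.
  rewrite (le_trans (ipnormD _ _ _))// mulrDr lerD//.
  rewrite (le_trans (hM _))// mulrCA (le_trans (ler_wpM2r (ipnorm_ge0 _ _) (ler_norm M)))//.
  by rewrite ler_wpM2l.
Qed.

End iteration.
End square_root.

(** * Norm continuous families of operators *)

Section norm_continuity.
Context {R : realType} {V : lmodType R[i]} (d : {dot V for Num.conj}).
Context {X : topologicalType} (x0 : X).
Implicit Types (U W : X -> V -> V).
Local Notation nrm := (ipnorm d).

(** Families are kept as bare functions, so that sums, composites and iterates need no bundled
    operators; a Lipschitz bound at the base point replaces linearity and boundedness. *)
Definition lipschitz0 (f : V -> V) := f 0 = 0 /\
  exists2 M : R, 0 <= M & forall v w, nrm (f v - f w) <= M * nrm (v - w).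

Definition norm_cont U := lipschitz0 (U x0) /\ forall e : R, 0 < e ->
  \forall x \near x0, forall v, nrm (U x v - U x0 v) <= e * nrm v.

Lemma bop_lipschitz0 (T : bounded_op d) : lipschitz0 T.
Proof.
split; first exact: linear0.
have [M hM] := bop_bounded T; exists `|M| => // v w.
rewrite -linearB (le_trans (hM _))// ler_wpM2r ?ipnorm_ge0//; exact: ler_norm.
Qed.

Lemma lipschitz0_norm (f : V -> V) : lipschitz0 f ->
  exists2 M : R, 0 <= M & forall v, nrm (f v) <= M * nrm v.
Proof.
by move=> [f0 [M M0 hM]]; exists M => // v; have := hM v 0; rewrite f0 !subr0.
Qed.

Lemma norm_cont_ext U W : (forall x v, U x v = W x v) -> norm_cont U -> norm_cont W.
Proof. by move=> UW; suff -> : U = W by []; apply/funext => x; exact/funext. Qed.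

Lemma norm_cont_cst (f : V -> V) : lipschitz0 f -> norm_cont (fun=> f).
Proof.
move=> lf; split => // e e0; apply: nearW => _ v.
by rewrite subrr ipnorm0 mulr_ge0 ?ipnorm_ge0 ?ltW.
Qed.

Lemma lipschitz0_id : lipschitz0 id.
Proof. by split => //; exists 1 => // v w; rewrite mul1r. Qed.

Lemma norm_contD U W : norm_cont U -> norm_cont W ->
  norm_cont (fun x v => U x v + W x v).
Proof.
move=> [[U0 [M M0 hM]] cU] [[W0 [N N0 hN]] cW]; split.
  split; first by rewrite U0 W0 addr0.
  exists (M + N); first exact: addr_ge0.
  move=> v w; rewrite opprD addrACA mulrDl (le_trans (ipnormD _ _ _))//.
  exact: lerD.
move=> e e0; have e20 : 0 < e / 2 by lra.
apply: filterS2 (cU _ e20) (cW _ e20) => x hU hW v.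
rewrite opprD addrACA (le_trans (ipnormD _ _ _))//.
by have := hU v; have := hW v; lra.
Qed.

Lemma norm_cont_comp U W : norm_cont U -> norm_cont W ->
  norm_cont (fun x v => U x (W x v)).
Proof.
move=> [[U0 [M M0 hM]] cU] [lW cW]; split.
  have [W0 [N N0 hN]] := lW; split; first by rewrite W0 U0.
  exists (M * N); first exact: mulr_ge0.
  by move=> v w; rewrite (le_trans (hM _ _))// -mulrA ler_wpM2l.
have [N N0 hN] := lipschitz0_norm lW.
move=> e e0; clear U0.
have h1 : 0 < e / (2 * (N + 1)) by rewrite divr_gt0// mulr_gt0// ltr_wpDl.
(* The cap 1 yields |W x v| <= (N + 1) |v| near [x0], which is the size of the argument of [U x] -
   [U x0]; the other entry compensates the Lipschitz constant of [U x0]. *)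
have h2 : 0 < Order.min 1 (e / (2 * (M + 1))).
  by rewrite lt_min ltr01 divr_gt0// mulr_gt0// ltr_wpDl.
apply: filterS2 (cU _ h1) (cW _ h2) => x hU hW v.
have v0 := ipnorm_ge0 d v.
apply: le_trans (ipnorm_trig _ _ (U x0 (W x v)) _) _.
have k1 : nrm (W x v - W x0 v) <= nrm v.
  by rewrite (le_trans (hW v))// ler_piMl// ge_min lexx.
have k2 : nrm (W x v - W x0 v) <= e / (2 * (M + 1)) * nrm v.
  by rewrite (le_trans (hW v))// ler_wpM2r// ge_min lexx orbT.
have k3 := hM (W x v) (W x0 v); have k4 := hU (W x v).
have k5 : nrm (W x v) <= (N + 1) * nrm v.
  by have := ipnorm_le_add d (W x v) (W x0 v); have := hN v; lra.
have k6 := ler_wpM2l (ltW h1) k5; have k7 := ler_wpM2l M0 k2.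
have e1 : e / (2 * (N + 1)) * ((N + 1) * nrm v) = e / 2 * nrm v by field; lra.
have e2 : M * (e / (2 * (M + 1)) * nrm v) <= e / 2 * nrm v.
  rewrite mulrA ler_wpM2r//.
  have -> : M * (e / (2 * (M + 1))) = e / 2 * (M / (M + 1)) by field; lra.
  by rewrite ler_piMr ?ler_pdivrMr ?mul1r ?ltr_wpDl// ?lerDl//; lra.
lra.
Qed.

Lemma norm_contZ (t : R) U : norm_cont U -> norm_cont (fun x v => t%:C *: U x v).
Proof.
apply: (@norm_cont_comp (fun=> *:%R t%:C)); apply: norm_cont_cst.
split; first by rewrite scaler0.
by exists `|t| => // v w; rewrite -scalerBr ipnormZr.
Qed.

Lemma norm_contB U W : norm_cont U -> norm_cont W ->
  norm_cont (fun x v => U x v - W x v).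
Proof.
move=> cU cW; apply: norm_cont_ext (norm_contD cU (norm_contZ (-1) cW)) => x v.
by rewrite rmorphN1 scaleN1r.
Qed.

Lemma norm_cont_iter U n : norm_cont U -> norm_cont (fun x v => iter n (U x) v).
Proof.
move=> cU; elim: n => [|n IH]; first by apply: norm_cont_cst; exact: lipschitz0_id.
exact: norm_cont_comp.
Qed.

Lemma norm_cont_approx U : lipschitz0 (U x0) ->
  (forall e : R, 0 < e -> exists2 W, norm_cont W &
    \forall x \near x0, forall v, nrm (U x v - W x v) <= e * nrm v) ->
  norm_cont U.
Proof.
move=> lU h; split => // e e0; have e30 : 0 < e / 3 by lra.
have [W [_ cW] UW] := h _ e30.
apply: filterS2 (UW) (cW _ e30) => x UWx Wx v.
have := UWx v; have := Wx v; have := nbhs_singleton UW v.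
rewrite (ipnormB d (U x0 v)); have := ipnorm_trig d (U x v) (W x v) (U x0 v).
have := ipnorm_trig d (W x v) (W x0 v) (U x0 v).
lra.
Qed.

Lemma norm_cont_sqrt_iter U n : norm_cont U ->
  norm_cont (fun x => sqrt_iter (U x) n).
Proof.
move=> cU; elim: n => [|n IH] /=.
  by apply: norm_cont_cst; split => //; exists 0 => // v w; rewrite subrr ipnorm0 mul0r.
by apply: norm_contZ; exact: norm_contD cU (norm_cont_comp IH IH).
Qed.

Lemma norm_cont_sqrt (C S : X -> bounded_op d) :
  norm_cont C ->
  (forall x n v, nrm (sqrt_iter (C x) n v - (v - S x v)) <=
     (1 - sqrt_maj n) * nrm v) ->
  norm_cont S.
Proof.
move=> cC h; apply: norm_cont_approx; first exact: bop_lipschitz0.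
move=> e e0.
have [n hn] : exists n, 1 - sqrt_maj n <= e.
  apply: contrapT => /forallNP H; suff : e <= 0 by lra.
  apply: (@sqrt_maj_small _ _ 1) => n; rewrite mulr1; apply/ltW.
  by rewrite ltNge; apply/negP/H.
exists (fun x v => v - sqrt_iter (C x) n v).
  apply: norm_contB; last exact: norm_cont_sqrt_iter.
  by apply: norm_cont_cst; exact: lipschitz0_id.
apply: nearW => x v.
have -> : S x v - (v - sqrt_iter (C x) n v) = sqrt_iter (C x) n v - (v - S x v).
  by apply: (@rdot_ext _ _ d) => w; rewrite !rdotE; ring.
by rewrite (le_trans (h _ _ _))// ler_wpM2r ?ipnorm_ge0.
Qed.

Lemma bop_dist_le_norm (S T : bounded_op d) v :
  nrm (S v - T v) <= bop_dist S T * nrm v.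
Proof.
have [v0|v0] := eqVneq (nrm v) 0.
  by rewrite (ipnorm_eq0 v0) (linear0 S) (linear0 T) subrr ipnorm0 mulr0.
have vp : 0 < nrm v by rewrite lt_def v0 ipnorm_ge0.
have := @bop_dist_ub _ _ d S T ((nrm v)^-1%:C *: v).
rewrite (linearZZ S) (linearZZ T) -scalerBr !ipnormZr gtr0_norm ?invr_gt0//.
rewrite mulVf// => /(_ (lexx _)).
by rewrite mulrC ler_pdivrMr.
Qed.

Lemma continuous_norm_cont (S : X -> bounded_op d) :
  {for x0, continuous S} -> norm_cont S.
Proof.
move=> cS; split; first exact: bop_lipschitz0.
move=> e e0; have /cvg_ballP/(_ e e0) := cS; apply: filterS => x.
rewrite ballEmdist => /ltW hx v; rewrite (le_trans (bop_dist_le_norm _ _ _))//.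
by rewrite ler_wpM2r ?ipnorm_ge0// bop_dist_sym.
Qed.

Lemma norm_cont_continuous (S : X -> bounded_op d) :
  norm_cont S -> {for x0, continuous S}.
Proof.
move=> [_ cS]; apply/cvg_ballP => e e0; have e20 : 0 < e / 2 by lra.
apply: filterS (cS _ e20) => x hx.
rewrite ballEmdist; apply: (@le_lt_trans _ _ (e / 2)); last by lra.
rewrite [leLHS]bop_dist_sym; apply: bop_dist_le => v v1.
by rewrite (le_trans (hx v))// ler_piMr// ltW.
Qed.

End norm_continuity.

Section orthogonal_sum_norm.
Context {R : realType} {V : lmodType R[i]} (d : {dot V for Num.conj}).
Implicit Types p q : V * V.

Lemma rdot_sum p q : rdot (dot_sum d) p q = rdot d p.1 q.1 + rdot d p.2 q.2.
Proof. by rewrite /rdot -raddfD. Qed.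

Lemma ipnorm_sum p : ipnorm (dot_sum d) p ^+ 2 = ipnorm d p.1 ^+ 2 + ipnorm d p.2 ^+ 2.
Proof. by rewrite -!rdot_nrm rdot_sum. Qed.

Lemma ipnorm_fst p : ipnorm d p.1 <= ipnorm (dot_sum d) p.
Proof.
by rewrite -(ler_pXn2r (n := 2)) ?nnegrE ?ipnorm_ge0// ipnorm_sum lerDl sqr_ge0.
Qed.

Lemma ipnorm_snd p : ipnorm d p.2 <= ipnorm (dot_sum d) p.
Proof.
by rewrite -(ler_pXn2r (n := 2)) ?nnegrE ?ipnorm_ge0// ipnorm_sum lerDr sqr_ge0.
Qed.

Lemma ipnorm_sum_le p : ipnorm (dot_sum d) p <= ipnorm d p.1 + ipnorm d p.2.
Proof.
have h1 := ipnorm_ge0 d p.1; have h2 := ipnorm_ge0 d p.2.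
rewrite -(ler_pXn2r (n := 2)) ?nnegrE ?ipnorm_ge0 ?addr_ge0//.
by rewrite ipnorm_sum; nra.
Qed.

End orthogonal_sum_norm.

(** * Completeness of the Hilbert space and of closed graphs *)

Section hilbert_space.
Context {R : realType} {H : completeNormedModType R[i]}.
Variable dot : {dot H for Num.conj}.
Hypothesis dot_norm : forall v : H, `|v| ^+ 2 = dot v v.
Implicit Types (u : nat -> H) (v l : H).
Local Notation nrm := (ipnorm dot).

Lemma normE v : `|v| = (nrm v)%:C.
Proof.
apply/eqP; rewrite -(eqrXn2 (n := 2)) ?ler0c ?ipnorm_ge0//.
rewrite dot_norm -rmorphXn /= ipnorm_sqr; apply/eqP.
by rewrite RRe_real// ger0_real// dnorm_ge0.
Qed.

Lemma ip_cvgP u l : ip_cvg dot u l <-> u @ \oo --> l.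
Proof.
split=> [h|/cvgrPdist_le h].
  apply/cvgrPdist_le => e e0; have [e' ee'] : exists e', e = e'%:C.
    by exists (complex.Re e); rewrite RRe_real// gtr0_real.
  have e'0 : 0 < e' by rewrite -ltcR -ee'.
  have [N hN] := h _ e'0; exists N => // n /= Nn.
  by rewrite normE ee' lecR ipnormB hN.
move=> e e0; have [|N _ hN] := h e%:C; first by rewrite ltcR.
by exists N => n Nn; have := hN n Nn; rewrite /= normE lecR ipnormB.
Qed.

Lemma hilbert_complete : ip_complete dot [set: H].
Proof.
move=> u _ cu.
suff /cauchy_cvgP/cvg_ex[l ul] : cauchy (u @ \oo) by exists l => //; exact/ip_cvgP.
apply/cauchy_ballP => e e0; have [e' ee'] : exists e', e = e'%:C.
  by exists (complex.Re e); rewrite RRe_real// gtr0_real.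
have e'0 : 0 < e' / 2 by rewrite divr_gt0// -ltcR -ee'.
have [N hN] := cu _ e'0.
rewrite near_map2; exists ([set n | (N <= n)%N], [set n | (N <= n)%N]) => /=.
  by split; exists N.
move=> [m n] /= [Nm Nn]; rewrite -ball_normE /= normE ee' ltcR.
by rewrite (le_lt_trans (hN _ _ Nm Nn))//; lra.
Qed.

Lemma closed_ip_complete (G : set (H * H)) : closed G -> ip_complete (dot_sum dot) G.
Proof.
move=> clG u Gu cu.
have [//||a _ ha] := @hilbert_complete (fun n => (u n).1).
  move=> e /cu[N hN]; exists N => m n Nm Nn.
  exact: le_trans (ipnorm_fst _ (u m - u n)) (hN _ _ Nm Nn).
have [//||b _ hb] := @hilbert_complete (fun n => (u n).2).
  move=> e /cu[N hN]; exists N => m n Nm Nn.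
  exact: le_trans (ipnorm_snd _ (u m - u n)) (hN _ _ Nm Nn).
exists (a, b).
  apply: (closed_cvg (u_ := u) (F := \oo)) => //; first exact: nearW.
  have -> : u = fun n => ((u n).1, (u n).2) by apply/funext => n; case: (u n).
  by apply: cvg_pair; exact/ip_cvgP.
move=> e e0; have e20 : 0 < e / 2 by lra.
have [N hN] := ha _ e20; have [M hM] := hb _ e20.
exists (maxn N M) => n; rewrite geq_max => /andP[/hN h1 /hM h2].
apply: le_trans (ipnorm_sum_le _ _) _ => /=; lra.
Qed.

End hilbert_space.

(** * Blocks of the projection onto the graph *)

Section compressions.
Context {R : realType} {V : lmodType R[i]} (d : {dot V for Num.conj}).
Variable P : bounded_op (dot_sum d).

Let pairl (a : R[i]) (u v : V) : (a *: u + v, 0) = a *: (u, 0) + (v, 0) :> V * V.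
Proof. by apply/pair_equal_spec; split => //=; rewrite scaler0 addr0. Qed.

Let nrm_pairl v : ipnorm (dot_sum d) (v, 0) = ipnorm d v.
Proof.
apply/eqP; rewrite -(eqrXn2 (n := 2)) ?ipnorm_ge0// ipnorm_sum /= ipnorm0.
by rewrite expr0n addr0.
Qed.

Lemma compress1_linear a u v : (P (a *: u + v, 0)).1 = a *: (P (u, 0)).1 + (P (v, 0)).1.
Proof. by rewrite pairl bop_linear. Qed.

Lemma compress2_linear a u v : (P (a *: u + v, 0)).2 = a *: (P (u, 0)).2 + (P (v, 0)).2.
Proof. by rewrite pairl bop_linear. Qed.

Lemma compress1_bounded :
  exists M : R, forall v, ipnorm d (P (v, 0)).1 <= M * ipnorm d v.
Proof.
have [M hM] := bop_bounded P; exists M => v.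
by rewrite (le_trans (ipnorm_fst _ _))// (le_trans (hM _))// nrm_pairl.
Qed.

Lemma compress2_bounded :
  exists M : R, forall v, ipnorm d (P (v, 0)).2 <= M * ipnorm d v.
Proof.
have [M hM] := bop_bounded P; exists M => v.
by rewrite (le_trans (ipnorm_snd _ _))// (le_trans (hM _))// nrm_pairl.
Qed.

Definition compress1 : bounded_op d := BoundedOp compress1_linear compress1_bounded.
Definition compress2 : bounded_op d := BoundedOp compress2_linear compress2_bounded.

Lemma compress1E v : compress1 v = (P (v, 0)).1. Proof. by []. Qed.

Lemma compress2E v : compress2 v = (P (v, 0)).2. Proof. by []. Qed.

End compressions.

Global Opaque compress1 compress2.

Lemma norm_cont_compress {R : realType} {V : lmodType R[i]}
    (d : {dot V for Num.conj}) (X : topologicalType) (x0 : X)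
    (P : X -> bounded_op (dot_sum d)) : norm_cont (dot_sum d) x0 P ->
  norm_cont d x0 (fun x => compress1 (P x)) /\
  norm_cont d x0 (fun x => compress2 (P x)).
Proof.
move=> [_ cP]; split; (split; first exact: bop_lipschitz0) => e e0;
  apply: filterS (cP e e0) => x hx v; have := hx (v, 0); rewrite !(compress1E, compress2E).
all: have -> : ipnorm (dot_sum d) (v, 0) = ipnorm d v by
  apply/eqP; rewrite -(eqrXn2 (n := 2)) ?ipnorm_ge0// ipnorm_sum /= ipnorm0 expr0n addr0.
  exact: le_trans (ipnorm_fst d (P x (v, 0) - P x0 (v, 0))).
exact: le_trans (ipnorm_snd d (P x (v, 0) - P x0 (v, 0))).
Qed.

Section self_adjoint_operator.
Context {R : realType} {H : completeNormedModType R[i]}.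
Variable dot : {dot H for Num.conj}.
Hypothesis dot_norm : forall v : H, `|v| ^+ 2 = dot v v.
Variable A : regular_op (H := H).
Hypothesis saA : self_adjoint dot A.
Local Notation nrm := (ipnorm dot).
Local Notation rd := (rdot dot).
Implicit Types u v w : H.

Lemma graph_linear_set : linear_set A.
Proof.
split; last by move=> a p q; exact: graph_linear.
by rewrite -saA => q _ /=; rewrite !linear0r.
Qed.

Lemma graph_sym v v' w w' : graph A (v, v') -> graph A (w, w') -> rd v' w = rd v w'.
Proof. by move=> Av; rewrite -{1}saA => /(_ _ Av) /= h; rewrite /rdot h. Qed.

(** Real parts suffice because the graph is stable under multiplication by i. *)
Lemma self_adjoint_graph v w :
  (forall u u', graph A (u, u') -> rd u' v = rd u w) -> graph A (v, w).
Proof.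
move=> h; rewrite -saA => -[u u'] Au /=; apply: dot_eq; first exact: h.
by apply: h; have := linear_setZ 'i graph_linear_set Au.
Qed.

Lemma graphB v v' w w' : graph A (v, v') -> graph A (w, w') -> graph A (v - w, v' - w').
Proof. exact: (linear_setB graph_linear_set (v := (v, v')) (w := (w, w'))). Qed.

Lemma graphD v v' w w' : graph A (v, v') -> graph A (w, w') -> graph A (v + w, v' + w').
Proof.
move=> Av Aw; have := linear_setP graph_linear_set Av Aw 1.
by rewrite scale1r.
Qed.

Lemma graph_projectionP :
  orthogonal_projection (dot_sum dot) (graph_projection dot A) /\
  range (graph_projection dot A) = A.
Proof.
have := exists_projection graph_linear_set
  (closed_ip_complete dot_norm (@graph_closed _ _ A)).
by move=> /(xgetPex (zero_bop (dot_sum dot))).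
Qed.

Let T := compress1 (graph_projection dot A).
Let B := compress2 (graph_projection dot A).

Lemma graph_TB w : graph A (T w, B w).
Proof.
have [_ h] := graph_projectionP; rewrite -[X in X _]h.
exists (w, 0) => //; rewrite /T /B compress1E compress2E.
by case: (graph_projection dot A _).
Qed.

(** The vector (w, 0) - P (w, 0) = (w - T w, - B w) is orthogonal to the graph; turned by a right
    angle, this says that (B w, w - T w) lies in the graph of A^* = A. *)
Lemma graph_BT w : graph A (B w, w - T w).
Proof.
have [[PP symP] h] := graph_projectionP; apply: self_adjoint_graph => u u' Au.
have := Au; rewrite -[X in X _]h => -[p _ Pp].
have := symP (w, 0) (u, u').
have -> : graph_projection dot A (u, u') = (u, u') by rewrite -Pp PP.
move=> /(congr1 (@complex.Re R)); rewrite -!/(rdot _ _ _) !rdot_sum /= rdot0l.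
rewrite addr0 !(rdotC dot _ u) !(rdotC dot _ u') rdotDr rdotNr /T /B compress1E compress2E.
lra.
Qed.

(** Injectivity of 1 + A^2: for the difference (a, b) of two solutions A a = b and A b = - a, so
    symmetry gives |b|^2 = - |a|^2. This is how identities for [T] and [B] are obtained below. *)
Lemma resolvent_unique v v' w : graph A (v, v') -> graph A (v', w - v) -> v = T w /\ v' = B w.
Proof.
move=> Av Av'; have h1 := graphB Av (graph_TB w); have h2 := graphB Av' (graph_BT w).
have := graph_sym h1 h2.
have -> : w - v - (w - T w) = - (v - T w).
  by apply: (@rdot_ext _ _ dot) => z; rewrite !rdotE; ring.
rewrite rdotNr; have := rdot_ge0 dot (v' - B w); have := rdot_ge0 dot (v - T w).
by split; apply/eqP; rewrite -subr_eq0; apply/eqP/(@rdot_eq0 _ _ dot); lra.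
Qed.

Lemma rdot_B_B u v : rd (B u) (B v) = rd (T u) (v - T v).
Proof. exact: graph_sym (graph_TB u) (graph_BT v). Qed.

Lemma T_sym : rsym dot T.
Proof.
move=> u v; have := rdot_B_B u v; have := rdot_B_B v u.
rewrite !rdotE (rdotC dot (B v)) (rdotC dot (T v) u) (rdotC dot (T v)); lra.
Qed.

Lemma B_sym : rsym dot B.
Proof.
move=> u v; have := graph_sym (graph_TB u) (graph_TB v).
have := graph_sym (graph_BT u) (graph_BT v).
by rewrite !rdotE; lra.
Qed.

(** A maps B (T w) to T w - T (T w), and A maps that to B w - B (T w), so this pair solves the
    resolvent equation for B w. *)
Lemma T_B_comm w : T (B w) = B (T w) /\ B (B w) = T w - T (T w).
Proof.
have [h1 h2] := resolvent_unique (graph_BT (T w)) (graphB (graph_TB w) (graph_TB (T w))).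
by rewrite -h1 -h2.
Qed.

Lemma T_inj w : T w = 0 -> w = 0.
Proof.
move=> Tw; have A0 := graph_linear_set.1; have := graph_TB w; have := graph_BT w.
rewrite Tw subr0 => h1 h2.
by rewrite (graph_functional h2 A0) in h1; exact: graph_functional h1 A0.
Qed.

(** Trades graph membership for an equation between bounded operators. For the converse, B w = v - T
    v by injectivity of [T], and then (v, w) = (T v, B v) + (B w, w - T w). *)
Lemma graphP v w : graph A (v, w) <-> T w = B v.
Proof.
split=> [Av|TB].
  by have [] := resolvent_unique (graph_BT v) (graphB Av (graph_TB v)).
have Bw : B w = v - T v.
  apply/eqP; rewrite -subr_eq0; apply/eqP/T_inj.
  by rewrite !bopB (T_B_comm w).1 TB (T_B_comm v).2 subrr.
have := graphD (graph_TB v) (graph_BT w).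
by rewrite Bw addrC subrK TB addrC subrK.
Qed.

(** The identity 1 = T^2 + 2 T (1 - T) + (1 - T)^2 with B^2 = T (1 - T). *)
Lemma ipnorm_TB w :
  nrm w ^+ 2 = nrm (T w) ^+ 2 + 2 * nrm (B w) ^+ 2 + nrm (w - T w) ^+ 2.
Proof.
have := ipnormD_sqr dot (w - T w) (T w); rewrite subrK => ->.
by rewrite (rdotC dot (w - T w)) -rdot_B_B rdot_nrm; ring.
Qed.

Lemma ipnorm_T w : nrm (T w) <= nrm w.
Proof.
rewrite -(ler_pXn2r (n := 2)) ?nnegrE ?ipnorm_ge0// (ipnorm_TB w).
by have := sqr_ge0 (nrm (B w)); have := sqr_ge0 (nrm (w - T w)); lra.
Qed.

Lemma ipnorm_1T w : nrm (w - T w) <= nrm w.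
Proof.
rewrite -(ler_pXn2r (n := 2)) ?nnegrE ?ipnorm_ge0// (ipnorm_TB w).
by have := sqr_ge0 (nrm (B w)); have := sqr_ge0 (nrm (T w)); lra.
Qed.

Lemma T_is_inverse :
  is_inverse (shift_graph (comp_graph (adjoint_graph dot A) A) 1) T.
Proof.
move=> v w; rewrite (_ : adjoint_graph dot A = A)//; split => [[z /=]|->].
  by rewrite scale1r => -[Av Az]; have [] := resolvent_unique Av Az.
by exists (B w); rewrite /= scale1r; split; [exact: graph_TB|exact: graph_BT].
Qed.

End self_adjoint_operator.

(** * Spectral measures *)

Section concentrated_measure.
Context {dT : measure_display} {T : measurableType dT} {R : realType}.
Variable mu : {measure set T -> \bar R}.
Variable S : set T.
Hypothesis mS : measurable S.
Hypothesis muS : mu (~` S) = 0%E.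

Lemma integral_concentrated (f : T -> \bar R) :
  measurable_fun setT f -> (\int[mu]_t f t = \int[mu]_(t in S) f t)%E.
Proof.
move=> mf; rewrite -(setUv S) integral_setU//.
- rewrite [X in (_ + X)%E]null_set_integral ?adde0//; first exact: measurableC.
  exact: measurable_funTS.
- exact: measurableC.
- by rewrite setUv.
- by apply/disj_set2P; rewrite setICr.
Qed.

Lemma Rintegral_concentrated (f : T -> R) :
  measurable_fun setT f -> \int[mu]_t f t = \int[mu]_(t in S) f t.
Proof.
by move=> mf; rewrite /Rintegral integral_concentrated//; exact/measurable_EFinP.
Qed.

Lemma measure_concentrated : mu setT = mu S.
Proof.
have mSC := measurableC mS.
by rewrite -(setUv S) measureU ?setICr// -[RHS]adde0; congr (_ + _)%E.
Qed.

End concentrated_measure.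

Lemma measurable_sqr {R : realType} :
  measurable_fun setT (fun t : measurableTypeR R => ((t : R) ^+ 2)%:E).
Proof. by apply: measurableT_comp => //; exact: exprn_measurable. Qed.

Section measure_second_moment.
Context {R : realType} (mu : {measure set (measurableTypeR R) -> \bar R}).
Variable S : set (measurableTypeR R).
Hypothesis mS : measurable S.
Hypothesis muS : mu (~` S) = 0%E.
Hypothesis muT : (mu setT < +oo)%E.
Hypothesis mu2 : (\int[mu]_t ((t : R) ^+ 2)%:E < +oo)%E.

(** The mass and the second moment are finite, and |t| <= 1 + t^2. *)
Lemma integrable_id : mu.-integrable setT (EFin \o (id : R -> R)).
Proof.
apply/integrableP; split; first by apply/measurable_EFinP; exact: measurable_id.
apply: (@le_lt_trans _ _ (\int[mu]_t (1 + ((t : R) ^+ 2)%:E))%E).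
  apply: ge0_le_integral => //=.
  - by apply: measurableT_comp => //; apply/measurable_EFinP; exact: measurable_id.
  - by apply: emeasurable_funD => //; exact: measurable_sqr.
  - move=> t _; rewrite lee_fin ler_norml; apply/andP; split; nra.
rewrite ge0_integralD//=; last first.
- exact: measurable_sqr.
- by move=> t _; rewrite lee_fin sqr_ge0.
have /(_ 1%:E)/= := integral_cst mu (@measurableT _ (measurableTypeR R)).
by rewrite mul1e => ->; rewrite lte_add_pinfty.
Qed.

Let mu_cst (c : R) : mu.-integrable S (EFin \o cst c).
Proof.
apply/integrableP; split; first by apply/measurable_EFinP; exact: measurable_cst.
rewrite /=; have /= -> := integral_cst mu mS `|c|%:E.
by rewrite lte_mul_pinfty ?lee_fin// -(measure_concentrated mS muS).
Qed.

Lemma Rintegral_ge_cst c : (forall t, S t -> c <= t) ->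
  c * fine (mu setT) <= \int[mu]_t (t : R).
Proof.
move=> cS; rewrite (measure_concentrated mS muS) -Rintegral_cst//.
rewrite [leRHS](Rintegral_concentrated mS muS); last exact: measurable_id.
apply: le_Rintegral => //; first exact: mu_cst.
exact: integrableS measurableT mS _ integrable_id.
Qed.

Lemma Rintegral_le_cst c : (forall t, S t -> t <= c) ->
  \int[mu]_t (t : R) <= c * fine (mu setT).
Proof.
move=> cS; rewrite (measure_concentrated mS muS) -Rintegral_cst//.
rewrite [leLHS](Rintegral_concentrated mS muS); last exact: measurable_id.
apply: le_Rintegral => //; last exact: mu_cst.
exact: integrableS measurableT mS _ integrable_id.
Qed.

End measure_second_moment.

Section spectral_measure.
Context {R : realType} {H : completeNormedModType R[i]}.
Variable dot : {dot H for Num.conj}.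
Variable A : regular_op (H := H).
Hypothesis saA : self_adjoint dot A.
Local Notation nrm := (ipnorm dot).
Local Notation rd := (rdot dot).
Implicit Types (u v w : H) (S U : set (measurableTypeR R)).
Variable E : set (measurableTypeR R) -> bounded_op dot.
Hypothesis hE : is_spectral_measure A E.

Lemma spectral_idem S v : measurable S -> E S (E S v) = E S v.
Proof. by case: hE => hP _ _ _ mS; exact: (hP _ mS).1. Qed.

Lemma spectral_sym S : measurable S -> rsym dot (E S).
Proof. by case: hE => hP _ _ _ mS u v; rewrite /rdot (hP _ mS).2. Qed.

Lemma spectralI S U v : measurable S -> measurable U -> E S (E U v) = E (S `&` U) v.
Proof. by case: hE => _ _ hI _ mS mU; rewrite hI. Qed.

Lemma spectral_measureP v : exists mu : {measure set (measurableTypeR R) -> \bar R},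
  [/\ forall S, measurable S -> mu S = (rd (E S v) v)%:E,
      domain A v <-> (\int[mu]_t ((t : R) ^+ 2)%:E < +oo)%E,
      (forall w, graph A (v, w) -> rd w v = \int[mu]_t (t : R)) &
      (mu setT < +oo)%E /\ fine (mu setT) = nrm v ^+ 2].
Proof.
case: hE => _ hT _ /(_ v)[mu [h1 h2 h3]]; exists mu; split => //.
- by move=> w /h3 h; rewrite /rdot h.
- by rewrite h1// ltry /= hT -/(rdot _ _ _) rdot_nrm.
Qed.

Lemma spectral0 v : E set0 v = 0.
Proof.
apply: (@rdot_eq0 _ _ dot); rewrite -(spectral_sym measurable0) (spectral_idem _ measurable0).
have [mu [h _ _ _]] := spectral_measureP v.
by have := h set0 measurable0; rewrite measure0 => -[].
Qed.

Lemma spectralC_fixed S u : measurable S -> E S u = u -> E (~` S) u = 0.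
Proof.
by move=> mS <-; rewrite spectralI// ?setICl ?spectral0//; exact: measurableC.
Qed.

(** The measure of [E S u] is that of u restricted to S, so its second moment can only be
    smaller. *)
Lemma spectral_domain S u : measurable S -> domain A u -> domain A (E S u).
Proof.
move=> mS; have [mu [mu1 mu2 _ _]] := spectral_measureP u.
have [nu [nu1 nu2 _ _]] := spectral_measureP (E S u).
have msq := @measurable_sqr R.
move=> /mu2 h; apply/nu2; rewrite (@integral_concentrated _ _ _ _ S)//; last first.
  rewrite nu1; last exact: measurableC.
  by rewrite spectralC_fixed// ?rdot0l// spectral_idem.
rewrite (eq_measure_integral mu).
  by apply: le_lt_trans h; apply: ge0_subset_integral => // t _; rewrite lee_fin sqr_ge0.
move=> U mU US; rewrite nu1// mu1// -(spectral_sym mS) !spectralI//; last exact: measurableI.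
by rewrite (setIidr US) (setIidl US).
Qed.

(** The measure of u + z is that of u on S and that of z off S, so the form of A is additive on u
    and z. The two cross terms are equal by symmetry, hence both zero. *)
Lemma spectral_form_split S u u' z z' : measurable S ->
  graph A (u, u') -> graph A (z, z') -> E S u = u -> E S z = 0 ->
  rd u' z = 0.
Proof.
move=> mS Au Az Eu Ez; have Auz := graphD saA Au Az.
have [mu [mu1 mu2 mu3 [mu4 _]]] := spectral_measureP u.
have [nu [nu1 nu2 nu3 [nu4 _]]] := spectral_measureP z.
have [la [la1 la2 la3 [la4 _]]] := spectral_measureP (u + z).
have mSC := measurableC mS.
have : rd (u' + z') (u + z) = rd u' u + rd z' z.
  rewrite (mu3 _ Au) (nu3 _ Az) (la3 _ Auz).
  have int : la.-integrable setT (EFin \o (id : R -> R)).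
    by apply: integrable_id => //; apply/la2; exists (u' + z').
  have := @Rintegral_setU _ _ _ la S (~` S) id mS mSC.
  rewrite setUv => ->//; last by apply/disj_set2P; rewrite setICr.
  congr (_ + _).
    have muSC : mu (~` S) = 0%E by rewrite mu1// spectralC_fixed// rdot0l.
    rewrite (Rintegral_concentrated mS muSC); last exact: measurable_id.
    rewrite /Rintegral; congr fine; apply: eq_measure_integral => U mU US.
    have EU : E U z = 0 by rewrite -(setIidl US) -spectralI// Ez bop0.
    by rewrite mu1// la1// bopD EU addr0 rdotDr (spectral_sym mU u z) EU rdot0r addr0.
  have nuSCC : nu (~` (~` S)) = 0%E by rewrite setCK nu1// Ez rdot0l.
  rewrite (Rintegral_concentrated mSC nuSCC); last exact: measurable_id.
  rewrite /Rintegral; congr fine; apply: eq_measure_integral => U mU US.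
  have EU : E U u = 0.
    rewrite -Eu spectralI// (_ : U `&` S = set0) ?spectral0//.
    by apply/disjoints_subset.
  by rewrite nu1// la1// bopD EU add0r rdotDr (spectral_sym mU z u) EU rdot0r add0r.
rewrite !rdotE => h; have := graph_sym saA Az Au; rewrite (rdotC dot z).
lra.
Qed.

(** Since A is self-adjoint, <A w, E u> = <w, E (A u)> for all w in the domain is enough. Splitting
    u and w by [E S], the mixed terms disappear by [spectral_form_split]. *)
Lemma spectral_reduces S u u' : measurable S ->
  graph A (u, u') -> graph A (E S u, E S u').
Proof.
move=> mS Au; apply: (self_adjoint_graph saA) => w w' Aw.
have [a Aa] := spectral_domain mS (ex_intro _ u' Au : domain A u).
have [b Ab] := spectral_domain mS (ex_intro _ w' Aw : domain A w).
have kill v : E S (v - E S v) = 0 by rewrite bopB spectral_idem// subrr.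
have h1 := spectral_form_split mS Aa (graphB saA Aw Ab) (spectral_idem _ mS) (kill w).
have h2 := spectral_form_split mS Ab (graphB saA Au Aa) (spectral_idem _ mS) (kill u).
have h3 := graph_sym saA (graphB saA Aw Ab) Aa.
have h4 := graph_sym saA Ab Au.
rewrite -[RHS](spectral_sym mS) -h4.
by move: h2 h3; rewrite (rdotC dot (w - E S w)) h1 !rdotE; lra.
Qed.

Lemma spectral_form_ge S c u u' : measurable S -> E (~` S) u = 0 ->
  (forall t, S t -> c <= t) -> graph A (u, u') -> c * nrm u ^+ 2 <= rd u' u.
Proof.
move=> mS Eu cS Au; have [mu [mu1 mu2 mu3 [mu4 <-]]] := spectral_measureP u.
rewrite (mu3 _ Au); apply: (@Rintegral_ge_cst _ mu S) => //.
  by rewrite mu1 ?Eu ?rdot0l//; exact: measurableC.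
by apply/mu2; exists u'.
Qed.

Lemma spectral_form_le S c u u' : measurable S -> E (~` S) u = 0 ->
  (forall t, S t -> t <= c) -> graph A (u, u') -> rd u' u <= c * nrm u ^+ 2.
Proof.
move=> mS Eu cS Au; have [mu [mu1 mu2 mu3 [mu4 <-]]] := spectral_measureP u.
rewrite (mu3 _ Au); apply: (@Rintegral_le_cst _ mu S) => //.
  by rewrite mu1 ?Eu ?rdot0l//; exact: measurableC.
by apply/mu2; exists u'.
Qed.

End spectral_measure.

(** * The bounded transform *)

Section operator_algebra.
Context {R : realType} {V : lmodType R[i]} (d : {dot V for Num.conj}).
Implicit Types (S T P Q : bounded_op d).
Local Notation nrm := (ipnorm d).

Lemma comp_linear S T a u v : S (T (a *: u + v)) = a *: S (T u) + S (T v).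
Proof. by rewrite !bop_linear. Qed.

Lemma comp_bounded S T : exists M : R, forall v, nrm (S (T v)) <= M * nrm v.
Proof.
have [M hM] := bop_bounded S; have [N hN] := bop_bounded T.
exists (`|M| * N) => v; rewrite (le_trans (hM _))// -mulrA.
rewrite (le_trans (ler_wpM2r (ipnorm_ge0 d (T v)) (ler_norm M)))//.
by rewrite ler_wpM2l.
Qed.

Definition comp_bop S T : bounded_op d := BoundedOp (comp_linear S T) (comp_bounded S T).

Lemma compl_linear T a u v :
  (a *: u + v) - T (a *: u + v) = a *: (u - T u) + (v - T v).
Proof. by rewrite bop_linear opprD addrACA scalerBr. Qed.

Lemma compl_bounded T : exists M : R, forall v, nrm (v - T v) <= M * nrm v.
Proof.
have [M hM] := bop_bounded T; exists (1 + M) => v.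
by rewrite mulrDl mul1r (le_trans (ipnormD _ _ _))// ipnormN lerD.
Qed.

Definition compl_bop T : bounded_op d := BoundedOp (compl_linear T) (compl_bounded T).

Lemma refl_linear P a u v : P (a *: u + v) + P (a *: u + v) - (a *: u + v) =
  a *: (P u + P u - u) + (P v + P v - v).
Proof.
by rewrite bop_linear scalerBr scalerDr opprD [X in X + _ = _]addrACA [LHS]addrACA.
Qed.

Lemma refl_bounded P : exists M : R, forall v, nrm (P v + P v - v) <= M * nrm v.
Proof.
have [M hM] := bop_bounded P; exists (M + M + 1) => v.
rewrite (le_trans (ipnormD _ _ _))// ipnormN !mulrDl mul1r lerD//.
by rewrite (le_trans (ipnormD _ _ _))// lerD.
Qed.

Definition refl_bop P : bounded_op d := BoundedOp (refl_linear P) (refl_bounded P).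

Lemma projection_sym P : orthogonal_projection d P -> rsym d P.
Proof. by move=> [_ h] u v; rewrite /rdot h. Qed.

Lemma ipnorm_projection P v : orthogonal_projection d P -> nrm (P v) <= nrm v.
Proof.
move=> hP; have := rdot_le d (P v) v.
rewrite -{1}(hP.1 v) projection_sym// rdot_nrm => h.
by have := ipnorm_ge0 d (P v); have := ipnorm_ge0 d v; nra.
Qed.

Lemma compl_projection P :
  orthogonal_projection d P -> orthogonal_projection d (compl_bop P).
Proof.
move=> [PP sP]; split=> [v|u v] /=; first by rewrite bopB PP subrr subr0.
by rewrite !(linearBl, linearBr) /= sP.
Qed.

Lemma ipnorm_refl P v : orthogonal_projection d P -> nrm (refl_bop P v) = nrm v.
Proof.
move=> hP; apply/eqP; rewrite -(eqrXn2 (n := 2)) ?ipnorm_ge0// -!rdot_nrm /=.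
have e : rdot d (P v) (P v) = rdot d (P v) v by rewrite -(projection_sym hP) hP.1.
by apply/eqP; rewrite !rdotE (rdotC d v) e; ring.
Qed.

(** As <P x, x> = |P x|^2, the order makes [P] vanish wherever [Q] does, in particular at v - Q v;
    the second identity is the adjoint of the first. *)
Lemma le_projection P Q : orthogonal_projection d P -> orthogonal_projection d Q ->
  le_op d P Q -> forall v, P (Q v) = P v /\ Q (P v) = P v.
Proof.
move=> hP hQ PQ.
have PQ1 v : P (Q v) = P v.
  apply/eqP; rewrite eq_sym -subr_eq0 -bopB; apply/eqP/(@rdot_eq0 _ _ d).
  apply/eqP; rewrite eq_le rdot_ge0 andbT.
  have := PQ (v - Q v); rewrite lecE => /andP[_].
  rewrite -!/(rdot _ _ _) -[X in rdot d X _ <= _]hP.1 (projection_sym hP).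
  by rewrite (bopB Q) hQ.1 subrr rdot0l.
move=> v; split => //; apply: (@rdot_ext _ _ d) => w.
by rewrite !(projection_sym hQ, projection_sym hP) PQ1.
Qed.

End operator_algebra.

Section bounded_transform_formula.
Context {R : realType} {H : completeNormedModType R[i]}.
Variable dot : {dot H for Num.conj}.
Hypothesis dot_norm : forall v : H, `|v| ^+ 2 = dot v v.
Variable A : regular_op (H := H).
Hypothesis saA : self_adjoint dot A.
Local Notation nrm := (ipnorm dot).
Local Notation rd := (rdot dot).
Local Notation T := (compress1 (graph_projection dot A)).
Local Notation B := (compress2 (graph_projection dot A)).
Variables S N : bounded_op dot.
Hypothesis hS : is_sqrt_compl (compl_bop T) S.
Hypothesis hN : is_sqrt_compl T N.
Implicit Types (u v w : H) (E : set (measurableTypeR R) -> bounded_op dot).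

Lemma SS v : S (S v) = T v.
Proof. by case: hS => _ ->; rewrite /= subKr. Qed.

Lemma NN v : N (N v) = v - T v.
Proof. by case: hN => _ ->. Qed.

Lemma S_comm (f : bounded_op dot) : (forall v, f (T v) = T (f v)) ->
  forall v, f (S v) = S (f v).
Proof. by move=> fT; case: hS => _ _ _ _; apply => v /=; rewrite bopB fT. Qed.

Lemma N_comm (f : bounded_op dot) : (forall v, f (T v) = T (f v)) ->
  forall v, f (N v) = N (f v).
Proof. by move=> fT; case: hN => _ _ _ _; apply. Qed.

Lemma S_T v : S (T v) = T (S v).
Proof. by rewrite -!SS. Qed.

Lemma S_N v : S (N v) = N (S v).
Proof. exact: N_comm S_T v. Qed.

Lemma B_T v : B (T v) = T (B v).
Proof. by rewrite (T_B_comm dot_norm saA v).1. Qed.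

Lemma ipnorm_N v : nrm (N v) <= nrm v.
Proof.
rewrite -(ler_pXn2r (n := 2)) ?nnegrE ?ipnorm_ge0// -rdot_nrm.
case: hN => -[sN _] _ _ _ _; rewrite sN NN (le_trans (rdot_le _ _ _))// expr2.
by rewrite ler_wpM2l ?ipnorm_ge0// ipnorm_1T.
Qed.

(** A product of commuting positive operators: with N = Q^2 and Q commuting with S, <N S v, v> = <S
    Q v, Q v>. *)
Lemma NS_positive v : 0 <= rd (N (S v)) v.
Proof.
have cN w : nrm (compl_bop N w) <= nrm w by case: hN => _ _ h _ _; exact: h.
have sN : rsym dot (compl_bop N).
  by case: hN => -[h _] _ _ _ _ u w; rewrite /= !rdotE h.
have [Q [[sQ _] QQ _ _ Qcomm]] := exists_sqrt sN cN (hilbert_complete dot_norm).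
have {}QQ w : Q (Q w) = N w by rewrite QQ /= subKr.
have SQ w : S (Q w) = Q (S w) by apply: Qcomm => z /=; rewrite bopB S_N.
by rewrite -QQ sQ -SQ; case: hS => -[_ h] _ _ _ _; exact: h.
Qed.

Section spectral_measure_of_A.
Variable E : set (measurableTypeR R) -> bounded_op dot.
Hypothesis hE : is_spectral_measure A E.

Lemma spectral_TB U v : measurable U -> E U (T v) = T (E U v) /\ E U (B v) = B (E U v).
Proof.
move=> mU; apply: resolvent_unique => //.
  by apply: (spectral_reduces saA hE mU); exact: graph_TB.
by rewrite -bopB; apply: (spectral_reduces saA hE mU); exact: graph_BT.
Qed.

Let Epos := E `]0, +oo[%classic.
(** The sign of A. On the kernel of A, where it equals -1, [N] vanishes. *)
Let J := refl_bop Epos.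

Let mpos : measurable (`]0, +oo[%classic : set (measurableTypeR R)).
Proof. exact: measurable_itv. Qed.

Let Epos_idem v : Epos (Epos v) = Epos v.
Proof. exact: (spectral_idem hE). Qed.

Let J_T v : J (T v) = T (J v).
Proof. by rewrite /= bopB bopD (spectral_TB v mpos).1. Qed.

Let J_B v : J (B v) = B (J v).
Proof. by rewrite /= bopB bopD (spectral_TB v mpos).2. Qed.

Let JJ v : J (J v) = v.
Proof.
rewrite /= !bopB !bopD !Epos_idem; apply: (@rdot_ext _ _ dot) => w.
by rewrite !rdotE; ring.
Qed.

(** Since B v = A (T v) and v - T v = A (B v), the form <B v, v> is the sum of the forms of A at T v
    and at B v. *)
Let B_form_ge0 v : Epos v = v -> 0 <= rd (B v) v.
Proof.
move=> Ev; have [ET EB] := spectral_TB v mpos; rewrite -!/Epos Ev in ET EB.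
have ge0 u u' : Epos u = u -> graph A (u, u') -> 0 <= rd u' u.
  move=> Eu Au; rewrite -(mul0r (nrm u ^+ 2)).
  apply: (spectral_form_ge hE mpos _ _ Au); first exact: (spectralC_fixed hE mpos Eu).
  by move=> t /=; rewrite in_itv /= andbT => /ltW.
have := ge0 _ _ ET (graph_TB dot_norm saA v).
have := ge0 _ _ EB (graph_BT dot_norm saA v).
rewrite !rdotE (rdotC dot v) (rdotC dot (T v)); lra.
Qed.

Let B_form_le0 v : Epos v = 0 -> rd (B v) v <= 0.
Proof.
move=> Ev; have [ET EB] := spectral_TB v mpos; rewrite -!/Epos Ev !bop0 in ET EB.
have le0 u u' : Epos u = 0 -> graph A (u, u') -> rd u' u <= 0.
  move=> Eu Au; rewrite -(mul0r (nrm u ^+ 2)).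
  apply: (spectral_form_le hE (measurableC mpos) _ _ Au); first by rewrite setCK.
  by move=> t /=; rewrite in_itv /= andbT => /negP; rewrite -leNgt.
have := le0 _ _ ET (graph_TB dot_norm saA v).
have := le0 _ _ EB (graph_BT dot_norm saA v).
rewrite !rdotE (rdotC dot v) (rdotC dot (T v)); lra.
Qed.

(** With v split by [Epos], B J v = B e - B e', and the cross terms cancel by symmetry of [B]. *)
Let BJ_positive v : 0 <= rd (B (J v)) v.
Proof.
set e := Epos v; set e' := v - e.
have Ee : Epos e = e := Epos_idem v.
have Ee' : Epos e' = 0 by rewrite bopB Ee subrr.
have -> : J v = e - e'.
  by apply: (@rdot_ext _ _ dot) => w; rewrite /= -/e !rdotE; ring.
have ve : v = e' + e by rewrite subrK.
clearbody e'; rewrite [X in rd _ X]ve bopB !rdotE.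
have := B_form_ge0 Ee; have := B_form_le0 Ee'; have := B_sym dot_norm saA e e'.
rewrite (rdotC dot e); lra.
Qed.

(* B J is the positive square root of B^2 = (N S)^2. *)
Lemma B_polar v : B v = N (S (J v)).
Proof.
have sT := T_sym dot_norm saA; have sB := B_sym dot_norm saA.
have [[sS _] _ _ _ _] := hS; have [[sN _] _ _ _ _] := hN.
have sJ : rsym dot J.
  by move=> u w; rewrite /= !rdotE (spectral_sym hE mpos).
have JN := N_comm J_T; have JS := S_comm J_T; have BN := N_comm B_T; have BS := S_comm B_T.
rewrite -{1}(JJ v).
apply: (positive_sqrt_unique (d := dot) (f := comp_bop B J) (g := comp_bop N S)).
- move=> u w; suff : rd (B (J u)) w = rd u (B (J w)) by [].
  by rewrite sB sJ J_B.
- exact: BJ_positive.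
- move=> u w; suff : rd (N (S u)) w = rd u (N (S w)) by [].
  by rewrite sN sS S_N.
- exact: NS_positive.
- move=> u; suff : B (J (N (S u))) = N (S (B (J u))) by [].
  by rewrite JN JS BN BS.
- move=> u; suff : B (J (B (J u))) = N (S (N (S u))) by [].
  by rewrite J_B JJ S_N NN !SS (T_B_comm dot_norm saA u).2.
Qed.

Let F := comp_bop N J.

Let T_F v : T (N (J v)) = B (S v).
Proof. by rewrite (N_comm (f := T))// -SS (S_comm B_T) B_polar S_N. Qed.

Lemma spectral_is_bounded_transform : is_bounded_transform A F.
Proof.
have [[sS pS] _ _ _ _] := hS.
exists S; last first.
  by move=> v; apply/(graphP dot_norm saA); exact: T_F.
split; first exact: rsym_positive.
by move=> v w; rewrite /= SS; exact: T_is_inverse.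
Qed.

(* The same holds for every spectral measure of A, so that the uniqueness of the
   spectral measure is not needed when Q and Q' come from different ones. *)
Lemma bounded_transformE v : bounded_transform dot A v = N (J v).
Proof.
rewrite /bounded_transform.
have [S' [pS' iS'] hF] := xgetPex (zero_bop dot)
  (ex_intro _ F spectral_is_bounded_transform).
set G := xget _ _ in hF *.
have S'S' w : S' (S' w) = T w.
  by have [_ /(_ erefl)] := T_is_inverse dot_norm saA (T w) w; move=> /iS'.
have [[sS pS] _ _ _ _] := hS.
have S'T w : S' (T w) = T (S' w) by rewrite -!S'S'.
(* [S'] commutes with its square [T], hence with [S], so uniqueness of commuting positive roots
   applies. *)
have SS'E w : S' w = S w.
  apply: (positive_sqrt_unique (d := dot)) => //.
  - exact: positive_rsym.
  - exact: positive_rdot.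
  - exact: S_comm.
  - by move=> u; suff : S' (S' u) = S (S u) by []; rewrite S'S' SS.
apply/eqP; rewrite -subr_eq0; apply/eqP/(T_inj dot_norm saA).
have := hF v; rewrite SS'E => /(graphP dot_norm saA).
by rewrite bopB T_F => ->; rewrite subrr.
Qed.

End spectral_measure_of_A.

End bounded_transform_formula.

(** * Spectral sections *)

Section spectral_section_estimate.
Context {R : realType} {H : completeNormedModType R[i]}.
Variable dot : {dot H for Num.conj}.
Hypothesis dot_norm : forall v : H, `|v| ^+ 2 = dot v v.
Variable A : regular_op (H := H).
Hypothesis saA : self_adjoint dot A.
Local Notation nrm := (ipnorm dot).
Local Notation rd := (rdot dot).
Local Notation T := (compress1 (graph_projection dot A)).
Local Notation B := (compress2 (graph_projection dot A)).
Local Notation C := (compl_bop T).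
Local Notation F := (bounded_transform dot A).
Variables S N : bounded_op dot.
Hypothesis hS : is_sqrt_compl C S.
Hypothesis hN : is_sqrt_compl T N.
Variables (P Q Q' : bounded_op dot) (r rho : R).
Hypothesis r_gt0 : 0 < r.
Hypothesis r_le : r <= rho.
Hypothesis hP : orthogonal_projection dot P.
Hypothesis hQ : is_spectral_projection A `[r, +oo[%classic Q.
Hypothesis hQ' : is_spectral_projection A `]- r, +oo[%classic Q'.
Hypothesis QP : le_op dot Q P.
Hypothesis PQ' : le_op dot P Q'.
Implicit Types u v w x : H.

Let measurable_ray (b : bool) (c : R) :
  measurable ([set` Interval (BSide b c) +oo%O] : set (measurableTypeR R)).
Proof. exact: measurable_itv. Qed.

Let projQ : orthogonal_projection dot Q.
Proof. by case: hQ => E [hE _ _ _] ->; exact: hE. Qed.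

Let projQ' : orthogonal_projection dot Q'.
Proof. by case: hQ' => E [hE _ _ _] ->; exact: hE. Qed.

Let PQ v : P (Q v) = Q v := (le_projection projQ hP QP v).2.

Let PQ'E v : P (Q' v) = P v := (le_projection hP projQ' PQ' v).1.

Let Q'Q v : Q' (Q v) = Q v.
Proof. by rewrite -PQ (le_projection hP projQ' PQ' _).2. Qed.

Let QQ' v : Q (Q' v) = Q v.
Proof.
have QPE w : Q (P w) = Q w := (le_projection projQ hP QP w).1.
by rewrite -QPE PQ'E QPE.
Qed.

Let Q_reduces u u' : graph A (u, u') -> graph A (Q u, Q u').
Proof. by case: hQ => E hE ->; exact: spectral_reduces. Qed.

Let Q'_reduces u u' : graph A (u, u') -> graph A (Q' u, Q' u').
Proof. by case: hQ' => E hE ->; exact: spectral_reduces. Qed.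

Let Q_T v : Q (T v) = T (Q v).
Proof. by case: hQ => E hE ->; exact: (spectral_TB _ _ hE v _).1. Qed.

Let Q'_T v : Q' (T v) = T (Q' v).
Proof. by case: hQ' => E hE ->; exact: (spectral_TB _ _ hE v _).1. Qed.

(** As r > 0, the ray [r, oo) lies in the positive half-line, where the sign of A is 1. *)
Lemma bounded_transform_above v : F (Q v) = N (Q v).
Proof.
have [E hE ->] := hQ.
rewrite (bounded_transformE dot_norm saA hS hN hE) /= (spectralI hE)//.
rewrite (_ : _ `&` _ = `[r, +oo[%classic) ?addrK//.
by apply/setIidr => t /=; rewrite !in_itv /= !andbT; exact: lt_le_trans.
Qed.

Lemma bounded_transform_below v : F (v - Q' v) = - N (v - Q' v).
Proof.
have [E hE ->] := hQ'.
rewrite (bounded_transformE dot_norm saA hS hN hE) /= (bopB (E _)) (spectralI hE)//.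
rewrite (_ : _ `&` _ = `]0, +oo[%classic).
  by rewrite subrr addr0 sub0r bopN.
apply/setIidl => t /=; rewrite !in_itv /= !andbT; apply: lt_trans.
by rewrite oppr_lt0.
Qed.

Lemma ipnorm_bounded_transform v : nrm (F v) <= nrm v.
Proof.
have [E hE _] := hQ.
rewrite (bounded_transformE dot_norm saA hS hN hE).
apply: le_trans (ipnorm_N dot_norm saA hN _) _.
by rewrite ipnorm_refl//; case: hE => h _ _ _; exact: h.
Qed.

Lemma bounded_transform_S v : F (S v) = B v.
Proof.
have [E hE _] := hQ.
rewrite (bounded_transformE dot_norm saA hS hN hE) (B_polar dot_norm saA hS hN hE).
congr (N _); apply: (S_comm hS) => w.
by rewrite /= bopB bopD (spectral_TB dot_norm saA hE w _).1.
Qed.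

Let K v := F v - refl_bop P (N v).

Let K_band v : K v = K (Q' v - Q v).
Proof.
have NQ := N_comm hN Q_T; have NQ' := N_comm hN Q'_T.
have KB u w : K (u - w) = K u - K w.
  by rewrite /K !bopB opprD addrACA -opprD.
have K1 : K (Q v) = 0.
  by rewrite /K bounded_transform_above /= -NQ PQ addrK subrr.
have K2 : K (v - Q' v) = 0.
  rewrite /K bounded_transform_below /= bopB -NQ' bopB PQ'E subrr addr0 sub0r.
  by rewrite opprK addrC subrr.
rewrite KB K1 subr0; apply/eqP; rewrite -subr_eq0 -KB K2.
exact/eqP.
Qed.

Let K_norm v : nrm (K v) <= 2 * nrm v.
Proof.
rewrite (le_trans (ipnormD _ _ _))// ipnormN ipnorm_refl//.
have := ipnorm_bounded_transform v; have := ipnorm_N dot_norm saA hN v; lra.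
Qed.

(** For a single spectral measure this is the range of the projection for (-r, r). [Q] and [Q'] may
    come from different ones, so both conditions are kept. *)
Let in_band v := Q v = 0 /\ Q' v = v.

Let band_proj v : in_band (Q' v - Q v).
Proof. by split; rewrite bopB ?QQ' ?Q'Q ?projQ.1 ?projQ'.1 ?subrr. Qed.

Let band_proj_norm v : nrm (Q' v - Q v) <= nrm v.
Proof.
rewrite -QQ'; apply: le_trans (ipnorm_projection _ projQ').
exact: ipnorm_projection (compl_projection projQ).
Qed.

Let band_graph u u' : graph A (u, u') -> in_band u -> in_band u'.
Proof.
move=> Au [Qu Q'u]; split.
  have := Q_reduces Au; rewrite Qu => h.
  exact: graph_functional h (graph_linear_set saA).1.
by have := Q'_reduces Au; rewrite Q'u => h; exact: graph_functional h Au.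
Qed.

Let band_form u u' : graph A (u, u') -> in_band u ->
  `|rd u' u| <= rho * nrm u ^+ 2.
Proof.
move=> Au [Qu Q'u]; have := sqr_ge0 (nrm u) => u0.
have h1 : rd u' u <= r * nrm u ^+ 2.
  have [E hE QE] := hQ; rewrite QE in Qu.
  apply: (spectral_form_le hE (measurableC (measurable_ray true r)) _ _ Au).
    by rewrite setCK.
  by move=> t /=; rewrite in_itv /= andbT => /negP; rewrite -ltNge => /ltW.
have h2 : - r * nrm u ^+ 2 <= rd u' u.
  have [E hE QE] := hQ'; rewrite QE in Q'u.
  apply: (spectral_form_ge hE (measurable_ray false (- r)) _ _ Au).
    exact: (spectralC_fixed hE _ Q'u).
  by move=> t /=; rewrite in_itv /= andbT => /ltW.
have h3 := ler_wpM2r u0 r_le.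
by rewrite ler_norml; apply/andP; split; lra.
Qed.

Let rho_gt0 : 0 < rho. Proof. exact: lt_le_trans r_le. Qed.

(* Polarization at a + t b and a - t b with t = 1 / rho. *)
Let band_norm a b c : graph A (a, b) -> graph A (b, c) -> in_band a ->
  nrm b <= rho * nrm a.
Proof.
move=> Aab Abc Da; have Db := band_graph Aab Da.
(* As <A b, a> = <b, A a> = |b|^2, the forms at a + t b and a - t b differ by 4 t |b|^2; the
   parallelogram identity evaluates the sum of their bounds. *)
have key t : 4 * t * nrm b ^+ 2 <= 2 * rho * (nrm a ^+ 2 + t ^+ 2 * nrm b ^+ 2).
  have Atb := linear_setZ t%:C (graph_linear_set saA) Abc.
  have band_tb : in_band (t%:C *: b).
    by split; rewrite bopZ; [rewrite Db.1 scaler0|rewrite Db.2].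
  have Dp : in_band (a + t%:C *: b).
    by split; rewrite bopD ?Da.1 ?band_tb.1 ?addr0 ?Da.2 ?band_tb.2.
  have Dm : in_band (a - t%:C *: b).
    by split; rewrite bopB ?Da.1 ?band_tb.1 ?subr0 ?Da.2 ?band_tb.2.
  have := band_form (graphD saA Aab Atb) Dp.
  have := band_form (graphB saA Aab Atb) Dm.
  rewrite !ler_norml => /andP[h1 _] /andP[_ h2].
  have := ipnormDB dot a (t%:C *: b).
  have -> : nrm (t%:C *: b) ^+ 2 = t ^+ 2 * nrm b ^+ 2 by rewrite ipnormZr exprMn real_normK ?num_real.
  move=> /(congr1 ( *%R rho)) e; have e2 := graph_sym saA Abc Aab.
  move: h1 h2; rewrite !rdotE e2 rdot_nrm => h1 h2.
  lra.
have := key rho^-1; have : rho * rho^-1 = 1 by rewrite divff// gt_eqF.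
move: (rho^-1) => t kt h.
rewrite -(ler_pXn2r (n := 2)) ?nnegrE ?mulr_ge0 ?ipnorm_ge0 ?(ltW rho_gt0)//.
move: h; rewrite exprMn; move: (nrm a ^+ 2) (nrm b ^+ 2) => al be h.
have e2 : rho * (t ^+ 2 * be) = t * be by rewrite expr2 !mulrA kt mul1r.
have h2 : t * be <= rho * al by lra.
have := ler_wpM2l (ltW rho_gt0) h2; rewrite mulrA kt; lra.
Qed.

Let q := rho ^+ 2 / (1 + rho ^+ 2).

(** Applying [band_norm] to T x and to B x gives |C x| <= rho |B x| and |B x| <= rho |T x|. Inserted
    into [ipnorm_TB], this yields (1 + rho^2)^2 |C x|^2 <= rho^4 |x|^2. The estimate for B x applies
    A to x - T x, whence the assumption that x is in the domain. *)
Let band_dom_contract x x' : graph A (x, x') -> in_band x -> nrm (C x) <= q * nrm x.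
Proof.
move=> Ax Dx; have h1 := graph_TB dot_norm saA x; have h2 := graph_BT dot_norm saA x.
have Da : in_band (T x) by split; rewrite ?Q_T ?Q'_T ?Dx.1 ?Dx.2 ?bop0.
have Db := band_graph h1 Da.
have n1 := band_norm h1 h2 Da; have n2 := band_norm h2 (graphB saA Ax h1) Db.
have := ipnorm_TB dot_norm saA x; rewrite -[x - T x]/(C x) in n2 *.
have := ipnorm_ge0 dot (T x); have := ipnorm_ge0 dot (B x); have := ipnorm_ge0 dot (C x).
have := ipnorm_ge0 dot x; move: n1 n2.
move: (nrm x) (nrm (T x)) (nrm (B x)) (nrm (C x)) => z a b c n1 n2 z0 c0 b0 a0 e.
have r2 : 0 < 1 + rho ^+ 2 by rewrite ltr_wpDr ?sqr_ge0.
rewrite /q mulrAC ler_pdivlMr//.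
rewrite -(ler_pXn2r (n := 2)) ?nnegrE ?mulr_ge0 ?sqr_ge0 ?(ltW r2) ?(ltW rho_gt0)//.
have k1 : c ^+ 2 <= rho ^+ 2 * b ^+ 2.
  by rewrite -exprMn ler_pXn2r ?nnegrE ?mulr_ge0// ltW.
have k2 : b ^+ 2 <= rho ^+ 2 * a ^+ 2.
  by rewrite -exprMn ler_pXn2r ?nnegrE ?mulr_ge0// ltW.
rewrite !exprMn e.
have rr : 0 <= rho ^+ 2 := sqr_ge0 _.
have k3 := ler_wpM2l rr k1; have k4 := ler_wpM2l rr k2.
have k5 := ler_wpM2l rr k4.
lra.
Qed.

Let q_ge0 : 0 <= q. Proof. by rewrite divr_ge0 ?addr_ge0 ?sqr_ge0. Qed.

(* The band meets the domain of A in a dense subset of the band. *)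
Let band_contract x : in_band x -> nrm (C x) <= q * nrm x.
Proof.
move=> Dx; apply/ler_addgt0Pr => e e0.
have q1 : 0 < 1 + q by rewrite ltr_wpDr.
(* Chosen so that |C x| <= |C (x - y)| + |C y| <= k + q (|x| + k) = q |x| + e. *)
set k := e / (1 + q); have k0 : 0 < k by rewrite divr_gt0.
have ek : k + q * k = e by rewrite -[X in X + _]mul1r -mulrDl mulrC divfK// gt_eqF.
clearbody k.
have [z [kz [z' Az]]] : ball x k%:C `&` domain A !=set0.
  apply: (@graph_dense _ _ A); last exact: ball_open.
  by exists x; apply: ballxx; rewrite ltcR.
have xz : nrm (z - x) <= k.
  by move: kz; rewrite -ball_normE /= (normE dot_norm) ltcR ipnormB => /ltW.
(* Projecting z into the band keeps it in the domain and, as x is fixed by this projection, brings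
   it no farther from x. *)
set y := Q' z - Q z.
have Ay := graphB saA (Q'_reduces Az) (Q_reduces Az).
have yx : nrm (y - x) <= k.
  have -> : y - x = Q' (z - x) - Q (z - x).
    rewrite !bopB Dx.1 Dx.2.
    by apply: (@rdot_ext _ _ dot) => w; rewrite !rdotE rdot0l; ring.
  exact: le_trans (band_proj_norm _) xz.
have := band_dom_contract Ay (band_proj z).
have := ipnorm_1T dot_norm saA (x - y); rewrite -[x - y - _]/(C (x - y)) bopB (ipnormB dot x).
have := ipnorm_le_add dot (C x) (C y); have := ipnorm_le_add dot y x.
have := q_ge0; nra.
Qed.

Let Cn n v := iter n C v.

Let band_iter n x : in_band x -> in_band (Cn n x) /\ nrm (Cn n x) <= q ^+ n * nrm x.
Proof.
move=> Dx; elim: n => [|n [[D1 D2] IH]] /=; first by rewrite expr0 mul1r.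
split; last first.
  rewrite exprS -mulrA (le_trans (band_contract _))//.
  by rewrite ler_wpM2l.
split; first by rewrite bopB Q_T -/(Cn n x) D1 bop0 subrr.
by rewrite bopB Q'_T -/(Cn n x) D2.
Qed.

Lemma bounded_transform_approx n v :
  nrm (F v - (F (v - iter n C v) + refl_bop P (N (iter n C v)))) <=
    2 * q ^+ n * nrm v.
Proof.
have -> : F v - (F (v - iter n C v) + refl_bop P (N (iter n C v))) = K (iter n C v).
  rewrite /K bopB; apply: (@rdot_ext _ _ dot) => w; rewrite !rdotE; ring.
rewrite K_band.
have DC : Q' (iter n C v) - Q (iter n C v) = iter n C (Q' v - Q v).
  elim: n => //= n IH; rewrite -IH !bopB Q_T Q'_T.
  by apply: (@rdot_ext _ _ dot) => w; rewrite !rdotE; ring.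
rewrite DC (le_trans (K_norm _))// -mulrA ler_wpM2l//.
apply: le_trans (band_iter n (band_proj v)).2 _.
by rewrite ler_wpM2l ?exprn_ge0.
Qed.

End spectral_section_estimate.

(** * Norm continuity of the bounded transform in the parameter *)

Section families.
Context {R : realType} {H : completeNormedModType R[i]}.
Variable dot : {dot H for Num.conj}.
Hypothesis dot_norm : forall v : H, `|v| ^+ 2 = dot v v.
Context {X : topologicalType} (x0 : X).
Variable A : X -> regular_op (H := H).
Hypothesis saA : forall x, self_adjoint dot (A x).
Local Notation T x := (compress1 (graph_projection dot (A x))).
Local Notation B x := (compress2 (graph_projection dot (A x))).
Local Notation C x := (compl_bop (T x)).
Local Notation F x := (bounded_transform dot (A x)).
Variables S N : X -> bounded_op dot.
Hypothesis hS : forall x, is_sqrt_compl (C x) (S x).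
Hypothesis hN : forall x, is_sqrt_compl (T x) (N x).
Hypothesis cT : norm_cont dot x0 (fun x => T x).
Hypothesis cB : norm_cont dot x0 (fun x => B x).
Hypothesis FS : forall x v, F x (S x v) = B x v.

Let cC : norm_cont dot x0 (fun x => C x).
Proof. by apply: norm_contB cT; apply: norm_cont_cst; exact: lipschitz0_id. Qed.

Let cS : norm_cont dot x0 S.
Proof. by apply: norm_cont_sqrt cC _ => x; case: (hS x). Qed.

Let cN : norm_cont dot x0 N.
Proof. by apply: norm_cont_sqrt cT _ => x; case: (hN x). Qed.

(** One term of the geometric sum per step of the induction: v - C^(n+1) v = (v - C^n v) + T C^n v,
    with F T = F S S. *)
Let cF n : norm_cont dot x0 (fun x v => F x (v - iter n (C x) v)).
Proof.
elim: n => [|n IH].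
  apply: (@norm_cont_ext _ _ _ _ _ (fun _ _ => 0)).
    by move=> x v; rewrite /= subrr bop0.
  by apply: norm_cont_cst; split => //; exists 0 => // v w; rewrite subrr ipnorm0 mul0r.
have cFT : norm_cont dot x0 (fun x v => F x (T x (iter n (C x) v))).
  apply: (@norm_cont_ext _ _ _ _ _ (fun x v => B x (S x (iter n (C x) v)))).
    by move=> x v; rewrite -(SS (hS x)) FS.
  exact: norm_cont_comp cB (norm_cont_comp cS (norm_cont_iter n cC)).
apply: norm_cont_ext (norm_contD IH cFT) => x v; rewrite -bopD; congr (F x _).
by apply: (@rdot_ext _ _ dot) => w; rewrite /= !rdotE; ring.
Qed.

Lemma norm_cont_bounded_transform (P : X -> bounded_op dot) (q : R) :
  0 <= q < 1 -> norm_cont dot x0 P ->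
  (\forall x \near x0, forall n v, ipnorm dot
     (F x v - (F x (v - iter n (C x) v) + refl_bop (P x) (N x (iter n (C x) v))))
     <= 2 * q ^+ n * ipnorm dot v) ->
  norm_cont dot x0 (fun x => F x).
Proof.
move=> /andP[q0 q1] cP h; apply: norm_cont_approx; first exact: bop_lipschitz0.
move=> e e0; have [n qn] : exists n, 2 * q ^+ n <= e.
  have /cvgrPdist_le/(_ (e / 2)) : (fun n => q ^+ n) @ \oo --> (0 : R).
    by apply: cvg_expr; rewrite ger0_norm.
  move=> [|n _ /(_ n (leqnn _))]; first by lra.
  by rewrite sub0r normrN ger0_norm ?exprn_ge0// => ?; exists n; lra.
exists (fun x v => F x (v - iter n (C x) v) + refl_bop (P x) (N x (iter n (C x) v))).
  have cI := norm_cont_iter n cC.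
  have cNI := norm_cont_comp cN cI.
  apply: norm_contD (cF n) (norm_contB (norm_contD _ _) cNI);
    exact: norm_cont_comp cP cNI.
apply: filterS h => x hx v; rewrite (le_trans (hx n v))//.
by rewrite ler_wpM2r ?ipnorm_ge0.
Qed.

End families.

Theorem theorem12p1 (R : realType) (H : completeNormedModType R[i])
    (dot : {dot H for Num.conj}) (dot_norm : forall v : H, `|v| ^+ 2 = dot v v)
    (H_separable : separable H) (H_infinite : infinite_dimensional H)
    (X : topologicalType) (A : X -> regular_sa_compact dot) :
  graph_continuous dot A ->
  (exists P : X -> bounded_op dot, spectral_section A P) ->
  riesz_continuous dot A.
Proof.
move=> cA [P [cP projP [r [cr r0 hr]]]].
have saA x : self_adjoint dot (A x) := rsc_self_adjoint (A x).
pose T x := compress1 (graph_projection dot (A x)).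
have symT x : rsym dot (T x) := T_sym dot_norm (saA x).
have symC x : rsym dot (compl_bop (T x)).
  by move=> u v; rewrite /= !rdotE symT.
have cH := hilbert_complete dot_norm.
have /choice[S hS] x : exists S, is_sqrt_compl (compl_bop (T x)) S.
  by apply: exists_sqrt => // v; exact: ipnorm_1T.
have /choice[N hN] x : exists N, is_sqrt_compl (T x) N.
  by apply: exists_sqrt => // v; exact: ipnorm_T.
apply: continuous_comp_initial => x0; apply: norm_cont_continuous.
have cG : {for x0, continuous (fun x => graph_projection dot (A x))}.
  apply: (continuous_comp (f := (fun x => A x : graph_space dot))).
    exact: cA.
  exact: initial_continuous.
have [cT cB] := norm_cont_compress (continuous_norm_cont cG).
(* The section supplies a spectral measure of [A x], which gives access to the polar formula for
   F. *)
have FS x v : bounded_transform dot (A x) (S x v) =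
    compress2 (graph_projection dot (A x)) v.
  have [Q [Q' [hQ _ _ _]]] := hr x.
  exact: (bounded_transform_S dot_norm (saA x) (hS x) (hN x) hQ).
(* Any number above [r x0] bounds [r] on a neighbourhood of [x0], which gives one contraction factor
   there for all x. *)
pose rho := r x0 + 1.
have rho2 : 0 < 1 + rho ^+ 2 by rewrite ltr_wpDr ?sqr_ge0.
apply: (norm_cont_bounded_transform (q := rho ^+ 2 / (1 + rho ^+ 2)) hS hN cT cB FS).
- by rewrite divr_ge0 ?sqr_ge0 ?(ltW rho2)//= ltr_pdivrMr// mul1r ltrDr.
- exact/continuous_norm_cont/cP.
have : \forall x \near x0, r x <= rho.
  have /cvgrPdist_le/(_ 1 ltr01) := cr x0; apply: filterS => x.
  by rewrite ler_norml /rho => /andP[h _]; lra.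
apply: filterS => x rx n v.
have [Q [Q' [hQ hQ' QP PQ']]] := hr x.
exact: (bounded_transform_approx dot_norm (saA x) (hS x) (hN x) (r0 x) rx (projP x)
  hQ hQ' QP PQ').
Qed.
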